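(* Let $G:\mathbb{C}\to\mathbb{C}^{m\times m}$ be a discrete-time, symmetric, real, rational, proper transfer function. Then $G(z)$ is D-SSNI if and only if all of the following hold: (i) $G(z)$ has all its poles with magnitude strictly less than unity; (ii) $i\,[G(e^{i\theta})-G(e^{i\theta})^*]>0$ for all $\theta\in(0,\pi)$; (iii) $Q_0:=\lim_{\theta\to0^+}\frac{1}{\sin\theta}\,i\,[G(e^{i\theta})-G(e^{i\theta})^*]>0$; (iv) $Q_\pi:=\lim_{\theta\to\pi^-}\frac{1}{\sin\theta}\,i\,[G(e^{i\theta})-G(e^{i\theta})^*]>0$.
   Context: $i$ is the imaginary unit; $A^*$ is the conjugate transpose and $A^\top$ the transpose; $\ge0$ and $>0$ (likewise $\le 0$, $<0$) denote positive semidefiniteness and positive definiteness of Hermitian matrices. A rational transfer function is real if its entries are rational functions with real coefficients, symmetric if $G(z)=G(z)^\top$, and proper if $G(\infty)$ is finite. A function analytic or harmonic in a region $\Omega$ has full normal rank if its determinant is nonzero at some point of $\Omega$. D-NI (discrete negative imaginary): a real transfer function $G$ that is analytic in $\{|z|>1\}$ and such that, for all $z$ with $|z|>1$: $i[G(z)-G(z)^*]\ge0$ if $\mathrm{Im}\,z>0$; $i[G(z)-G(z)^*]=0$ if $\mathrm{Im}\,z=0$; $i[G(z)-G(z)^*]\le0$ if $\mathrm{Im}\,z<0$. D-SSNI (discrete strongly strictly negative imaginary): a real transfer function $G$ such that, for some $\delta\in(0,1)$, the transfer function $z\mapsto G(\delta z)$ is D-NI, and $i[G(z)-G(1/z)^\top]$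 has full normal rank. *)

(* Defs.v *)
From HB Require Import structures.
From mathcomp Require Import all_boot all_order all_algebra generic_quotient.
From mathcomp Require Import all_classical all_reals all_analysis.
From mathcomp Require Import complex.
Set Implicit Arguments.
Unset Strict Implicit.
Unset Printing Implicit Defensive.
Import Order.TTheory GRing.Theory Num.Theory.
Import numFieldNormedType.Exports.
Local Open Scope classical_set_scope.
Local Open Scope ring_scope.
Local Open Scope complex_scope.
Local Open Scope sesquilinear_scope.

(* The usual topology of the complex plane, induced by the modulus. *)
HB.instance Definition _ (R : rcfType) := NormedModule.copy R[i] R[i]^o.

Definition ratfun (R : realType) := {fraction {poly R}}.

(* Numerator and denominator in lowest terms (up to a common nonzero
   constant), so that the poles of f are exactly the roots of [den f]. *)
Definition num (R : realType) (f : ratfun R) : {poly R} :=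
  let r := repr f in r.1 %/ gcdp r.1 r.2.

Definition den (R : realType) (f : ratfun R) : {poly R} :=
  let r := repr f in r.2 %/ gcdp r.1 r.2.

Definition horner_complex (R : realType) (p : {poly R}) (z : R[i]) : R[i] :=
  (map_poly (real_complex R) p).[z].

Definition pole (R : realType) (f : ratfun R) (z : R[i]) : Prop :=
  horner_complex (den f) z = 0.

(* The value at a pole is the junk value 0; f is unbounded around its poles, so
   it is neither continuous nor differentiable there. *)
Definition ratfun_eval (R : realType) (f : ratfun R) (z : R[i]) : R[i] :=
  horner_complex (num f) z / horner_complex (den f) z.

(* The rational function z |-> f (d * z). *)
Definition ratfun_dilate (R : realType) (d : R) (f : ratfun R) : ratfun R :=
  FracField.tofrac (num f \Po (d *: 'X)) / FracField.tofrac (den f \Po (d *: 'X)).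

Section TransferFunctions.
Variables (R : realType) (m : nat).

Definition tf := 'M[ratfun R]_m.

Definition tf_eval (G : tf) (z : R[i]) : 'M[R[i]]_m :=
  map_mx (fun f => ratfun_eval f z) G.

Definition tf_pole (G : tf) (z : R[i]) : Prop :=
  exists i j : 'I_m, pole (G i j) z.

Definition tf_dilate (d : R) (G : tf) : tf := map_mx (ratfun_dilate d) G.

Definition symmetric_tf (G : tf) : Prop := G^T = G.

(* G(oo) is the limit of G(1/w) as w tends to 0, w <> 0. *)
Definition proper_tf (G : tf) : Prop :=
  exists Ginf : 'M[R[i]]_m, tf_eval G w^-1 @[w --> 0^'] --> Ginf.

(* Complex differentiability at every point of Omega; this is analyticity as
   soon as Omega is open. *)
Definition analytic_in (Omega : set R[i]) (F : R[i] -> 'M[R[i]]_m) : Prop :=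
  forall z, Omega z -> forall i j : 'I_m, derivable (fun w => F w i j) z 1.

Definition full_normal_rank (Omega : set R[i]) (F : R[i] -> 'M[R[i]]_m) : Prop :=
  exists2 z, Omega z & \det (F z) != 0.

(* In the order of R[i], 0 <= c and 0 < c entail that c is real. *)
Definition possemidef (A : 'M[R[i]]_m) : Prop :=
  A \is hermsymmx /\ forall v : 'cV[R[i]]_m, 0 <= (v^t* *m A *m v) 0 0.

Definition posdef (A : 'M[R[i]]_m) : Prop :=
  A \is hermsymmx /\
  forall v : 'cV[R[i]]_m, v != 0 -> 0 < (v^t* *m A *m v) 0 0.

Definition negsemidef (A : 'M[R[i]]_m) : Prop := possemidef (- A).

Definition ni_form (A : 'M[R[i]]_m) : 'M[R[i]]_m := 'i *: (A - A^t*).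

Definition DNI (G : tf) : Prop :=
  analytic_in [set z | 1 < `|z|] (tf_eval G) /\
  forall z : R[i], 1 < `|z| ->
    [/\ 0 < complex.Im z -> possemidef (ni_form (tf_eval G z)),
        complex.Im z = 0 -> ni_form (tf_eval G z) = 0
      & complex.Im z < 0 -> negsemidef (ni_form (tf_eval G z))].

(* Points at which both G(z) and G(1/z) are defined. *)
Definition reciprocal_domain (G : tf) : set R[i] :=
  [set z | [/\ z != 0, ~ tf_pole G z & ~ tf_pole G z^-1]].

Definition DSSNI (G : tf) : Prop :=
  (exists2 delta : R, 0 < delta < 1 & DNI (tf_dilate delta G)) /\
  full_normal_rank (reciprocal_domain G)
    (fun z => 'i *: (tf_eval G z - (tf_eval G z^-1)^T)).

End TransferFunctions.

Definition expi (R : realType) (t : R) : R[i] := cos t +i* sin t.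

(* Main.v *)
Require Import Defs.
From mathcomp Require Import all_boot all_order all_algebra.
From mathcomp Require Import generic_quotient ring lra.
From mathcomp Require Import all_classical all_reals all_analysis.
From mathcomp Require Import complex.
Import Order.TTheory GRing.Theory Num.Theory.
Import numFieldNormedType.Exports.
Local Open Scope classical_set_scope.
Local Open Scope ring_scope.
Local Open Scope complex_scope.
Set Implicit Arguments.
Unset Strict Implicit.
Unset Printing Implicit Defensive.

(** Since G is real and symmetric, i [G(z) - G(z)^*] is the real symmetric
    matrix - 2 Im G(z). It is therefore tested on real vectors a, and the theorem
    is about the signs of Im f_a for the scalar real rational functions
    f_a = a^T G a. The quotient Im f_a(z) / Im z extends to a continuous function
    on the plane minus the poles, real axis included ([im_slope], [slope_num]),
    and the limits Q_0 and Q_pi are given by the values of this extension at 1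
    and -1. Hence, when the closed exterior of the unit disc contains no pole, the
    conditions on the open arc and on the two limits together say that the
    extension is negative on the whole unit circle, for all nonzero a
    ([boundary_conditionsP]).

    Suppose that G is D-SSNI. Then for some d < 1 there is no pole outside the
    circle of radius d, and Im f_a <= 0 on the part of this exterior in the upper
    half-plane. Equality at one point of that part makes f_a constant, by the
    maximum principle ([Im_ratio_max_const]); as the form - 2 Im G(z) is
    semidefinite, a is then in the kernel of Im G(z), so G(z) a is real, hence
    constant as well, and a is in the kernel of G(z) - G(1/z)^T for all z, which
    contradicts the full normal rank ([Im_form_lt0]). At 1 and -1 the strict sign
    comes from a boundary point lemma of Hopf type ([slope_num_lt0]). Both lemmas
    hold because a nonconstant rational function is c + s (z - w)^k up to higher
    order near w, and the directions u that point into the region cannot all have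
    s u^k in the closed lower half-plane, except at a real w when k = 1 and s < 0.

    Conversely, negativity on the circle for all a extends to a slightly smaller
    circle, by compactness ([smaller_circle]). In the upper half-plane outside
    that circle Im f_a is nonpositive on the arc, vanishes on the real axis, and
    tends to 0 at infinity because G is proper, so the maximum principle
    ([Im_ratio_max]) makes it nonpositive throughout; conjugation gives the lower
    half-plane. The rank condition holds at the imaginary unit i, where
    G(1/z)^T = G(z)^*. *)

(** * Rational functions in lowest terms *)

Section HornerComplex.
Variable R : realType.
Implicit Types (p q : {poly R}) (z : R[i]).

Lemma horner_complex0 z : horner_complex 0 z = 0.
Proof. by rewrite /horner_complex rmorph0 horner0. Qed.

Lemma horner_complexD p q z :
  horner_complex (p + q) z = horner_complex p z + horner_complex q z.
Proof. by rewrite /horner_complex rmorphD hornerD. Qed.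

Lemma horner_complexM p q z :
  horner_complex (p * q) z = horner_complex p z * horner_complex q z.
Proof. by rewrite /horner_complex rmorphM hornerM. Qed.

Lemma horner_complexZ (c : R) q z :
  horner_complex (c *: q) z = c%:C * horner_complex q z.
Proof. by rewrite -mul_polyC horner_complexM /horner_complex map_polyC hornerC. Qed.

Lemma horner_complexMXaddC p (c : R) z :
  horner_complex (p * 'X + c%:P) z = horner_complex p z * z + c%:C.
Proof.
by rewrite /horner_complex rmorphD rmorphM /= map_polyX map_polyC hornerMXaddC.
Qed.

Lemma horner_complex_real p (x : R) : horner_complex p x%:C = (p.[x])%:C.
Proof. by rewrite /horner_complex horner_map. Qed.

Lemma horner_complex_conj p z : horner_complex p (z^*) = (horner_complex p z)^*.
Proof.
elim/poly_ind: p => [|p c IH]; first by rewrite !horner_complex0 rmorph0.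
by rewrite !horner_complexMXaddC IH rmorphD rmorphM /= oppr0.
Qed.

Lemma horner_complex_dilate (d : R) p z :
  horner_complex (p \Po (d *: 'X)) z = horner_complex p (d%:C * z).
Proof.
rewrite /horner_complex map_comp_poly horner_comp map_polyZ /= map_polyX.
by rewrite hornerZ hornerX.
Qed.

Lemma horner_complex_sum I (r : seq I) (F : I -> {poly R}) z :
  horner_complex (\sum_(j <- r) F j) z = \sum_(j <- r) horner_complex (F j) z.
Proof.
exact: (big_morph (fun p => horner_complex p z)
  (fun p q => horner_complexD p q z) (horner_complex0 z)).
Qed.

End HornerComplex.

Section LowestTerms.
Variable R : realType.
Implicit Types (f : ratfun R) (p q : {poly R}) (z : R[i]).

Lemma den_neq0 f : Defs.den f != 0.
Proof.
rewrite /Defs.den; set r := repr f.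
have r2 : r.2 != 0 by apply: denom_ratioP.
by rewrite dvdp_div_eq0 ?dvdp_gcdr.
Qed.

Lemma coprimep_num_den f : coprimep (Defs.num f) (Defs.den f).
Proof.
rewrite /Defs.num /Defs.den; apply: coprimep_div_gcd; apply/orP; right.
exact: denom_ratioP.
Qed.

Lemma ratfun_repr f :
  f = FracField.tofrac (repr f).1 / FracField.tofrac (repr f).2.
Proof.
have r2F : FracField.tofrac (repr f).2 != 0.
  by rewrite tofrac_eq0; apply: denom_ratioP.
apply: (mulIf r2F); rewrite divfK //.
rewrite -[f in LHS]reprK; unlock FracField.tofrac.
rewrite -[LHS]FracField.pi_mul; apply/eqmodP => /=.
rewrite FracField.equivfE /FracField.mulf.
by rewrite !numden_Ratio ?mulf_neq0 ?oner_neq0 ?denom_ratioP // ?mulr1 reprK mulrC.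
Qed.

(** The representative underlying [num] and [den] is an arbitrary one, so the
    only handle on it is cross-multiplication. *)
Lemma num_den_frac p q f : q != 0 ->
  f = FracField.tofrac p / FracField.tofrac q -> Defs.num f * q = p * Defs.den f.
Proof.
move=> q0 fpq.
have r2 : (repr f).2 != 0 by apply: denom_ratioP.
have g0 : gcdp (repr f).1 (repr f).2 != 0 by rewrite gcdp_eq0 (negPf r2) andbF.
have /eqP e : (repr f).1 * q == p * (repr f).2.
  rewrite -tofrac_eq !tofracM -GRing.eqr_div ?tofrac_eq0 //.
  by rewrite -ratfun_repr fpq.
apply: (mulIf g0); rewrite mulrAC [Defs.num _ * _]divpK ?dvdp_gcdl //.
by rewrite -mulrA [Defs.den _ * _]divpK ?dvdp_gcdr.
Qed.

(** Gauss: two reduced fractions with the same value differ by a unit, so a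
    common factor c remains undetermined but cancels in values and poles. *)
Lemma num_den_coprime p q f : q != 0 -> coprimep p q ->
  f = FracField.tofrac p / FracField.tofrac q ->
  exists2 c : R, c != 0 & Defs.num f = c *: p /\ Defs.den f = c *: q.
Proof.
move=> q0 cpq /(num_den_frac q0) e.
have : Defs.den f %= q.
  apply/andP; split.
    rewrite -(@Gauss_dvdpr _ q (Defs.num f)) 1?coprimep_sym ?coprimep_num_den//.
    by rewrite e dvdp_mulIr.
  rewrite -(@Gauss_dvdpr _ (Defs.den f) p) 1?coprimep_sym // -e.
  exact: dvdp_mulIr.
move=> /eqpP[[a b] /andP[/= a0 b0] ab].
have dE : Defs.den f = (b / a) *: q.
  by rewrite mulrC -scalerA -ab scalerA mulVf ?scale1r.
exists (b / a); first by rewrite mulf_neq0 ?invr_eq0.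
by split=> //; apply: (mulIf q0); rewrite e dE -scalerAr scalerAl.
Qed.

Lemma num_den_dilate (d : R) f : d != 0 -> exists2 c : R, c != 0 &
  Defs.num (ratfun_dilate d f) = c *: (Defs.num f \Po (d *: 'X)) /\
  Defs.den (ratfun_dilate d f) = c *: (Defs.den f \Po (d *: 'X)).
Proof.
move=> d0; apply: num_den_coprime => //.
  rewrite comp_poly2_eq0 ?den_neq0 // size_scale ?size_polyX //.
exact/coprimep_comp_poly/coprimep_num_den.
Qed.

Lemma ratfun_eval_dilate (d : R) f z : d != 0 ->
  ratfun_eval (ratfun_dilate d f) z = ratfun_eval f (d%:C * z).
Proof.
move=> /(num_den_dilate f)[c c0 [nE dE]]; rewrite /ratfun_eval nE dE.
rewrite !horner_complexZ !horner_complex_dilate -mulf_div divff ?mul1r //.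
by rewrite (fmorph_eq0 (real_complex R)).
Qed.

Lemma pole_dilate (d : R) f z : d != 0 ->
  pole (ratfun_dilate d f) z <-> pole f (d%:C * z).
Proof.
move=> /(num_den_dilate f)[c c0 [_ dE]].
rewrite /pole dE horner_complexZ horner_complex_dilate.
split=> [/eqP|->]; last by rewrite mulr0.
by rewrite mulf_eq0 (fmorph_eq0 (real_complex R)) (negPf c0) => /eqP.
Qed.

End LowestTerms.

Section CommonDenominator.
Variables (R : realType) (m : nat).
Implicit Types (G : tf R m) (z : R[i]).

(** A product, not a least common multiple: all that matters is that its roots
    are exactly the poles of the entries. *)
Definition tf_den G : {poly R} := \prod_i \prod_j Defs.den (G i j).

Definition tf_num G : 'M[{poly R}]_m :=
  \matrix_(i, j) (Defs.num (G i j) * (tf_den G %/ Defs.den (G i j))).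

Lemma den_dvd_tf_den G i j : Defs.den (G i j) %| tf_den G.
Proof.
by rewrite /tf_den (bigD1 i) //= (bigD1 j) //= -mulrA dvdp_mulIl.
Qed.

Lemma tf_poleE G z : tf_pole G z <-> horner_complex (tf_den G) z = 0.
Proof.
split=> [[i [j]]|].
  rewrite /pole => e; have /dvdpP[q ->] := den_dvd_tf_den G i j.
  by rewrite horner_complexM e mulr0.
rewrite /tf_den /horner_complex rmorph_prod horner_prod => /eqP.
move=> /prodf_eq0[i _]; rewrite rmorph_prod horner_prod => /prodf_eq0[j _ /eqP].
by exists i, j.
Qed.

Lemma tf_evalE G z i j : horner_complex (tf_den G) z != 0 ->
  tf_eval G z i j =
  horner_complex (tf_num G i j) z / horner_complex (tf_den G) z.
Proof.
rewrite !mxE; have /dvdpP[q qE] := den_dvd_tf_den G i j.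
rewrite {}qE mulpK ?den_neq0 // !horner_complexM mulf_eq0 negb_or => /andP[q0 d0].
by rewrite /ratfun_eval [horner_complex q z * _]mulrC -mulf_div divff // mulr1.
Qed.

Lemma tf_num_sym G : symmetric_tf G -> (tf_num G)^T = tf_num G.
Proof.
move=> s; apply/matrixP => i j; rewrite !mxE.
have e : G j i = G i j by rewrite -[in LHS]s mxE.
by rewrite e.
Qed.

Lemma tf_eval_dilate (d : R) G z : d != 0 ->
  tf_eval (tf_dilate d G) z = tf_eval G (d%:C * z).
Proof. by move=> d0; apply/matrixP => i j; rewrite !mxE ratfun_eval_dilate. Qed.

End CommonDenominator.

(** * Topology of the complex plane *)

Section ComplexTopology.
Variable R : realType.
Implicit Types (p q : {poly R}) (z : R[i]).

Lemma normc_sqr z : `|z| ^+ 2 = (complex.Re z ^+ 2 + complex.Im z ^+ 2)%:C.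
Proof. by rewrite add_Re2_Im2. Qed.

Lemma gt0_complex (e : R[i]) : 0 < e -> exists2 r : R, 0 < r & e = r%:C.
Proof.
case: e => a b; rewrite ltcE /= => /andP[/eqP -> a0].
by exists a.
Qed.

Lemma norm_real_complex (x : R) : `|x%:C| = `|x|%:C.
Proof. by rewrite normc_def /= expr0n addr0 sqrtr_sqr. Qed.

Lemma norm_Re_le z : `|complex.Re z|%:C <= `|z|.
Proof. exact: normc_ge_Re. Qed.

Lemma norm_Im_le z : `|complex.Im z|%:C <= `|z|.
Proof.
by rewrite normc_def lecR -sqrtr_sqr ler_wsqrtr // lerDr sqr_ge0.
Qed.

Lemma real_Im0 z : complex.Im z = 0 -> z = (complex.Re z)%:C.
Proof. by case: z => a b /= ->. Qed.

Lemma Re_realM (r : R) z : complex.Re (r%:C * z) = r * complex.Re z.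
Proof. by case: z => p q; simpc. Qed.

Lemma Im_realM (r : R) z : complex.Im (r%:C * z) = r * complex.Im z.
Proof. by case: z => a b; simpc. Qed.

Lemma Re2Im2_gt0 z : z != 0 -> 0 < complex.Re z ^+ 2 + complex.Im z ^+ 2.
Proof. by move=> z0; rewrite -ltcR -normc_sqr exprn_gt0 // normr_gt0. Qed.

Lemma Im_div (a b : R[i]) : complex.Im (a / b) =
  (complex.Im a * complex.Re b - complex.Re a * complex.Im b) /
  (complex.Re b ^+ 2 + complex.Im b ^+ 2).
Proof.
case: a b => [a1 a2] [b1 b2] /=; set n := (b1 ^+ 2 + b2 ^+ 2)^-1; ring.
Qed.

Lemma near_dist_lt z (e : R) : 0 < e -> \forall t \near z, `|z - t| < e%:C.
Proof. by move=> e0; apply: (nbhsx_ballx z); rewrite ltcR. Qed.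

Lemma continuous_Re : continuous (@complex.Re R : R[i] -> R).
Proof.
move=> z; apply: (iffRL (@cvgrPdist_lt R R _ (nbhs z) _ _ _)) => e e0.
apply: filterS (near_dist_lt z e0) => t.
by rewrite -ltcR -raddfB; apply: le_lt_trans (norm_Re_le _).
Qed.

Lemma continuous_Im : continuous (@complex.Im R : R[i] -> R).
Proof.
move=> z; apply: (iffRL (@cvgrPdist_lt R R _ (nbhs z) _ _ _)) => e e0.
apply: filterS (near_dist_lt z e0) => t.
by rewrite -ltcR -raddfB; apply: le_lt_trans (norm_Im_le _).
Qed.

Lemma continuous_real_complex : continuous (real_complex R : R -> R[i]).
Proof.
move=> x; apply: (iffRL (@cvgrPdist_lt _ _ _ (nbhs x) _ _ _)).
move=> _ /gt0_complex[e e0 ->]; apply: filterS (nbhsx_ballx x _ e0) => t.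
by rewrite -rmorphB /= norm_real_complex ltcR.
Qed.

Lemma continuous_complex_horner (P : {poly R[i]}) :
  continuous (fun z : R[i] => P.[z]).
Proof.
elim/poly_ind: P => [|P c IH] z.
  under eq_fun do rewrite horner0.
  exact: (@cvg_cst R[i] _ _ (nbhs z)).
under eq_fun do rewrite hornerMXaddC.
apply: (@cvgD R[i] R[i] _ (nbhs z)); last exact: (@cvg_cst R[i] _ _ (nbhs z)).
by apply: cvgM; [exact: IH|exact: cvg_id].
Qed.

Section Compositions.
Variables (T : Type) (F : set_system T).
Context {FF : Filter F}.

Lemma cvg_constC (c : R[i]) : (fun=> c) @ F --> c.
Proof. exact: cvg_cst. Qed.

Lemma cvg_addC (f g : T -> R[i]) (a b : R[i]) :
  f @ F --> a -> g @ F --> b -> f x + g x @[x --> F] --> a + b.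
Proof. exact: cvgD. Qed.

Lemma cvg_mulC (f g : T -> R[i]) (a b : R[i]) :
  f @ F --> a -> g @ F --> b -> f x * g x @[x --> F] --> a * b.
Proof. exact: cvgM. Qed.

Lemma cvg_invC (f : T -> R[i]) (a : R[i]) : a != 0 ->
  f @ F --> a -> (f x)^-1 @[x --> F] --> a^-1.
Proof. exact: cvgV. Qed.

Lemma cvg_Re (f : T -> R[i]) (a : R[i]) :
  f @ F --> a -> complex.Re (f x) @[x --> F] --> complex.Re a.
Proof. by move=> fa; apply: cvg_comp fa _; apply: continuous_Re. Qed.

Lemma cvg_Im (f : T -> R[i]) (a : R[i]) :
  f @ F --> a -> complex.Im (f x) @[x --> F] --> complex.Im a.
Proof. by move=> fa; apply: cvg_comp fa _; apply: continuous_Im. Qed.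

Lemma cvg_real_complex (f : T -> R) (a : R) :
  f @ F --> a -> (f x)%:C @[x --> F] --> a%:C.
Proof. by move=> fa; apply: cvg_comp fa _; apply: continuous_real_complex. Qed.

Lemma cvg_horner_poly (P : {poly R[i]}) (f : T -> R[i]) (a : R[i]) :
  f @ F --> a -> P.[f x] @[x --> F] --> P.[a].
Proof. by move=> fa; apply: cvg_comp fa _; apply: continuous_complex_horner. Qed.

End Compositions.

Lemma continuous_complex_pair : continuous (fun u : R * R => u.1 +i* u.2).
Proof.
move=> u; apply: (iffRL (@cvgrPdist_lt R[i] R[i] _ (nbhs u) _ _ _)).
move=> _ /gt0_complex[e e0 ->].
have e20 : 0 < e / 2 by rewrite divr_gt0.
near=> t.
have -> : (u.1 +i* u.2) - (t.1 +i* t.2) =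
    (u.1 - t.1)%:C + 'i * (u.2 - t.2)%:C :> R[i].
  by simpc.
apply: le_lt_trans (ler_normD _ _) _.
rewrite normrM !norm_real_complex.
have -> : `|'i : R[i]| = 1 by rewrite normc_def /= expr0n expr1n add0r sqrtr1.
rewrite mul1r -rmorphD /= ltcR [e]splitr ltrD //.
  near: t; apply: (@cvgr_dist_lt _ _ _ (nbhs u) _ _ _ _ _ e20).
  exact: cvg_fst.
near: t; apply: (@cvgr_dist_lt _ _ _ (nbhs u) _ _ _ _ _ e20).
exact: cvg_snd.
Unshelve. all: by end_near. Qed.

Lemma compact_complex (A : set R[i]) (M : R) : closed A ->
  (forall z, A z -> `|complex.Re z| <= M /\ `|complex.Im z| <= M) -> compact A.
Proof.
move=> cA AM.
pose K : set (R * R) := `[(- M), M] `*` `[(- M), M].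
have cK : compact K by apply: compact_setX; exact: segment_compact.
have := continuous_compact (continuous_subspaceT continuous_complex_pair) cK.
move/(subclosed_compact cA); apply => z /AM[zr zi].
exists (complex.Re z, complex.Im z); last by case: z {zr zi}.
by split; rewrite /= in_itv /= -ler_norml.
Qed.

End ComplexTopology.

Section Modulus.
Variable R : realType.
Implicit Types z : R[i].

(** The norm of [R[i]] takes its values in [R[i]]; compactness and order
    arguments need it in the real line. *)
Definition modulus z : R := complex.Re `|z|.

Lemma normE z : `|z| = (modulus z)%:C.
Proof. by rewrite /modulus normc_def. Qed.

Lemma gt_modulus z (x : R) : (x%:C < `|z|) = (x < modulus z).
Proof. by rewrite normE ltcR. Qed.

Lemma lt_modulus z (x : R) : (`|z| < x%:C) = (modulus z < x).
Proof. by rewrite normE ltcR. Qed.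

Lemma continuous_modulus : continuous (modulus : R[i] -> R).
Proof. by move=> z; apply: cvg_Re; apply: (@cvg_norm R[i] R[i] _ (nbhs z)). Qed.

Lemma Re_le_modulus z : `|complex.Re z| <= modulus z.
Proof. by rewrite -lecR -normE norm_Re_le. Qed.

Lemma Im_le_modulus z : `|complex.Im z| <= modulus z.
Proof. by rewrite -lecR -normE norm_Im_le. Qed.

Lemma modulus_real (x : R) : modulus x%:C = `|x|.
Proof. by rewrite /modulus norm_real_complex. Qed.

Lemma modulusM z w : modulus (z * w) = modulus z * modulus w.
Proof. by apply: complexI; rewrite -normE normrM !normE rmorphM. Qed.

Lemma modulus_conj z : modulus (z^*) = modulus z.
Proof. by rewrite /modulus normcJ. Qed.

Lemma modulus_i : modulus ('i : R[i]) = 1.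
Proof. by rewrite /modulus normc_def /= expr0n expr1n add0r sqrtr1. Qed.

Lemma closed_preimage (f : R[i] -> R) (A : set R) :
  continuous f -> closed A -> closed (f @^-1` A).
Proof. by move=> cf; apply: preimage_closed => z _; apply: cf. Qed.

Lemma compact_circle : compact [set z : R[i] | modulus z = 1].
Proof.
apply: (@compact_complex _ _ 1); last first.
  by move=> z /= <-; split; [exact: Re_le_modulus|exact: Im_le_modulus].
apply: (@closed_preimage (@modulus) [set 1]); first exact: continuous_modulus.
exact: closed_eq.
Qed.

(** The tube lemma around the compact product of the circle and K. *)
Lemma near_circle_lt0 (T : topologicalType) (K : set T) (h : R[i] * T -> R) :
  compact K -> continuous h ->
  (forall z x, modulus z = 1 -> K x -> h (z, x) < 0) ->
  \forall r \near (1 : R), forall z x, modulus z = 1 -> K x -> h (r%:C * z, x) < 0.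
Proof.
move=> cK ch hlt0.
have /compact_near_coveringP cov := compact_setX compact_circle cK.
have := cov _ (nbhs (1 : R)) (fun r u => h (r%:C * u.1, u.2) < 0) _.
have near_u u : ([set z : R[i] | modulus z = 1] `*` K) u ->
    \forall u' \near u & r \near (1 : R), h (r%:C * u'.1, u'.2) < 0.
  move=> [/= u1 Ku2].
  have cv1 : v.1 @[v --> (u, 1 : R)] --> u by exact: cvg_fst.
  have cv2 : v.2 @[v --> (u, 1 : R)] --> (1 : R) by exact: cvg_snd.
  have cv11 : v.1.1 @[v --> (u, 1 : R)] --> u.1.
    by apply: (cvg_comp _ _ cv1); exact: cvg_fst.
  have cv12 : v.1.2 @[v --> (u, 1 : R)] --> u.2.
    by apply: (cvg_comp _ _ cv1); exact: cvg_snd.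
  have ch0 : h (v.2%:C * v.1.1, v.1.2) @[v --> (u, 1 : R)] --> h ((1 : R)%:C * u.1, u.2).
    apply: (@cvg_comp _ _ _ (fun v : (R[i] * T) * R => (v.2%:C * v.1.1, v.1.2)) h
      _ (nbhs ((1 : R)%:C * u.1, u.2))); last exact: ch.
    have cv := cvg_mulC (cvg_real_complex cv2) cv11.
    apply: (@cvg_pair _ _ _ (nbhs (u, 1 : R)) (nbhs ((1 : R)%:C * u.1)) (nbhs u.2)).
      exact: cv.
    exact: cv12.
  have h0 : h ((1 : R)%:C * u.1, u.2) < 0 by rewrite mul1r; apply: hlt0.
  have [AB nAB sAB] : \forall v \near (u, 1 : R), h (v.2%:C * v.1.1, v.1.2) < 0.
    exact: (cvgr_lt _ ch0 _ h0).
  by exists AB => // v /sAB.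
move=> /(_ _ near_u); apply: filterS => r H z x z1 Kx.
by apply: (H (z, x)).
Qed.

End Modulus.

(** * The imaginary part divided by the imaginary part of the argument *)

Section RealPolynomials.
Variable R : realType.
Implicit Types (p q : {poly R}) (z : R[i]).

Lemma continuous_horner_complex p : continuous (horner_complex p).
Proof. exact: continuous_complex_horner. Qed.

(** Im (p z) / Im z, extended by its limit, the derivative of p, on the real
    axis. Having one continuous function on the whole plane treats the arc and
    its two real end points alike. *)
Definition im_slope p z : R :=
  if complex.Im z == 0 then p^`().[complex.Re z]
  else complex.Im (horner_complex p z) / complex.Im z.

Lemma Im_horner_complex p z :
  complex.Im (horner_complex p z) = complex.Im z * im_slope p z.
Proof.
rewrite /im_slope; case: eqP => [z0|/eqP z0]; last by rewrite mulrC divfK.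
by rewrite [z in LHS]real_Im0 // horner_complex_real z0 mul0r.
Qed.

(** The recursion from which continuity follows with no case analysis at the
    real axis. *)
Lemma im_slopeMXaddC p (c : R) z :
  im_slope (p * 'X + c%:P) z =
  complex.Re (horner_complex p z) + complex.Re z * im_slope p z.
Proof.
rewrite /im_slope; case: eqP => [z0|/eqP z0].
  rewrite {2}[z]real_Im0 // horner_complex_real /= derivMXaddC.
  by rewrite hornerD hornerMX mulrC.
rewrite horner_complexMXaddC; case: z z0 => a b /= b0.
case: (horner_complex p _) => u v; simpc => /=.
by field.
Qed.

Lemma continuous_im_slope p : continuous (im_slope p).
Proof.
elim/poly_ind: p => [|p c IH] z.
  rewrite (_ : im_slope 0 = fun=> 0).
    exact: (@cvg_cst R _ _ (nbhs z)).
  apply/funext => w; rewrite /im_slope deriv0 horner0 horner_complex0.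
  by rewrite mul0r if_same.
rewrite (_ : im_slope _ = fun w =>
  complex.Re (horner_complex p w) + complex.Re w * im_slope p w); last first.
  by apply/funext => w; rewrite im_slopeMXaddC.
apply: (@cvgD R R _ (nbhs z)).
  apply: (@cvg_comp _ _ _ (horner_complex p) (@complex.Re R)).
    exact: continuous_horner_complex.
  exact: continuous_Re.
apply: (@cvgM R _ (nbhs z)); first exact: continuous_Re.
exact: IH.
Qed.

Lemma im_slope_conj p z : im_slope p (z^*) = im_slope p z.
Proof.
rewrite /im_slope horner_complex_conj; case: z => a b /=.
rewrite oppr_eq0; case: eqP => // _.
by case: horner_complex => u v /=; rewrite invrN mulrNN.
Qed.

Lemma im_slopeD (p q : {poly R}) z : im_slope (p + q) z = im_slope p z + im_slope q z.
Proof.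
rewrite /im_slope; case: eqP => _; first by rewrite derivD hornerD.
by rewrite horner_complexD raddfD mulrDl.
Qed.

Lemma im_slopeZ (c : R) (p : {poly R}) z : im_slope (c *: p) z = c * im_slope p z.
Proof.
rewrite /im_slope; case: eqP => _; first by rewrite derivZ hornerZ.
by rewrite horner_complexZ Im_realM mulrA.
Qed.

(** The numerator of Im (p z / q z) / Im z over the positive denominator
    |q z|^2; on the real axis it is the Wronskian p' q - p q'. *)
Definition slope_num p q z : R :=
  im_slope p z * complex.Re (horner_complex q z)
  - complex.Re (horner_complex p z) * im_slope q z.

Lemma Im_ratio p q z :
  complex.Im (horner_complex p z / horner_complex q z) =
  complex.Im z * (slope_num p q z /
    (complex.Re (horner_complex q z) ^+ 2 + complex.Im (horner_complex q z) ^+ 2)).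
Proof.
rewrite Im_div mulrA; congr (_ / _).
by rewrite !Im_horner_complex /slope_num; ring.
Qed.

Lemma slope_num_conj p q z : slope_num p q (z^*) = slope_num p q z.
Proof.
rewrite /slope_num !im_slope_conj !horner_complex_conj.
by case: (horner_complex p z) (horner_complex q z) => ? ? [].
Qed.

Lemma slope_num_real p q (x : R) :
  slope_num p q x%:C = p^`().[x] * q.[x] - p.[x] * q^`().[x].
Proof. by rewrite /slope_num /im_slope !horner_complex_real eqxx. Qed.

Lemma slope_numD (p1 p2 q : {poly R}) z :
  slope_num (p1 + p2) q z = slope_num p1 q z + slope_num p2 q z.
Proof.
by rewrite /slope_num im_slopeD horner_complexD raddfD /=; ring.
Qed.

Lemma slope_numZ (c : R) (p q : {poly R}) z :
  slope_num (c *: p) q z = c * slope_num p q z.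
Proof.
by rewrite /slope_num im_slopeZ horner_complexZ Re_realM; ring.
Qed.

Lemma slope_num0 (q : {poly R}) z : slope_num 0 q z = 0.
Proof. by rewrite -(scale0r (0 : {poly R})) slope_numZ mul0r. Qed.

Lemma continuous_slope_num (p q : {poly R}) : continuous (slope_num p q).
Proof.
move=> z; have cRe (r : {poly R}) :=
  @cvg_Re R _ (nbhs z) _ _ (@continuous_horner_complex r z).
apply: (@cvgB R R _ (nbhs z)); apply: (@cvgM R _ (nbhs z)).
- exact: continuous_im_slope.
- exact: cRe.
- exact: cRe.
- exact: continuous_im_slope.
Qed.

Lemma Im_ratio_conj (p q : {poly R}) z :
  complex.Im (horner_complex p (z^*) / horner_complex q (z^*)) =
  - complex.Im (horner_complex p z / horner_complex q z).
Proof.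
rewrite !Im_ratio slope_num_conj horner_complex_conj -mulNr.
by case: z => x y; case: horner_complex => ? ? /=; rewrite sqrrN.
Qed.

Lemma horner_complex_ratio_cvg p q z : horner_complex q z != 0 ->
  horner_complex p w / horner_complex q w @[w --> z] -->
  horner_complex p z / horner_complex q z.
Proof.
move=> qz; apply: (@cvg_mulC R _ (nbhs z)).
  exact: (@continuous_horner_complex p z).
exact: (cvg_invC qz (@continuous_horner_complex q z)).
Qed.

End RealPolynomials.

(** * Maximum principle and boundary point lemma for rational functions *)

Section LocalExpansion.
Variable R : realType.
Implicit Types (p q : {poly R}) (z w u : R[i]).

Lemma continuous_ray (w u : R[i]) : (w + t%:C * u) @[t --> (0 : R)] --> w.
Proof.
have := cvg_addC (@cvg_constC R _ (nbhs (0 : R)) _ w)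
  (cvg_mulC (@continuous_real_complex R 0) (@cvg_constC R _ (nbhs (0 : R)) _ u)).
by rewrite mul0r addr0 => cvg_ray; exact: cvg_ray.
Qed.

Lemma near_at_right (A : set R) (x : R) :
  (\forall t \near x, A t) -> \forall t \near x^'+, A t.
Proof. by move=> Ax; apply: cvg_within Ax. Qed.

Lemma near_ray (A : set R[i]) w u :
  (\forall z \near w, A z) -> \forall t \near (0 : R)^'+, A (w + t%:C * u).
Proof. by move=> Aw; apply: near_at_right; apply: continuous_ray Aw. Qed.

(** Along the ray w + t u, the ratio P / Q behaves like its leading term
    t^k u^k S(w) / Q(w), whose imaginary part has the sign of the hypothesis. *)
Lemma near_ray_Im_gt0 (P S Q : {poly R[i]}) w u k :
  P = S * ('X - w%:P) ^+ k -> Q.[w] != 0 ->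
  0 < complex.Im (u ^+ k * (S.[w] / Q.[w])) ->
  \forall t \near (0 : R)^'+,
    0 < complex.Im (P.[w + t%:C * u] / Q.[w + t%:C * u]).
Proof.
move=> PE Qw Sgt0.
have cray := @continuous_ray w u.
have : complex.Im (u ^+ k * (S.[w + t%:C * u] / Q.[w + t%:C * u]))
    @[t --> (0 : R)] --> complex.Im (u ^+ k * (S.[w] / Q.[w])).
  apply: cvg_Im; apply: cvg_mulC; first exact: cvg_constC.
  apply: cvg_mulC; first exact: (cvg_horner_poly cray).
  exact: (cvg_invC Qw (cvg_horner_poly cray)).
move=> cIm; have pos := near_at_right (cvgr_gt _ cIm _ Sgt0).
near=> t; have t0 : 0 < t by [].
have Sgt : 0 < complex.Im (u ^+ k * (S.[w + t%:C * u] / Q.[w + t%:C * u])).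
  by near: t; exact: pos.
have -> : P.[w + t%:C * u] / Q.[w + t%:C * u] =
    (t ^+ k)%:C * (u ^+ k * (S.[w + t%:C * u] / Q.[w + t%:C * u])).
  rewrite PE hornerM horner_exp hornerXsubC [w + _]addrC addrK exprMn rmorphXn /=.
  by ring.
by rewrite Im_realM mulr_gt0 // exprn_gt0.
Unshelve. all: by end_near. Qed.

(** Strong maximum principle: if p / q were not constant, its expansion
    c + s (z - w)^k at w would reach values above c in some direction. *)
Lemma Im_ratio_max_const p q w : horner_complex q w != 0 ->
  (\forall z \near w, complex.Im (horner_complex p z / horner_complex q z) <=
     complex.Im (horner_complex p w / horner_complex q w)) ->
  forall z, horner_complex p z =
    horner_complex p w / horner_complex q w * horner_complex q z.
Proof.
move=> qw0; set c := _ w / _ => cmax z; apply/eqP; rewrite -subr_eq0.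
pose P := map_poly (real_complex R) p - c *: map_poly (real_complex R) q.
pose Q := map_poly (real_complex R) q.
have PE v : P.[v] = horner_complex p v - c * horner_complex q v.
  by rewrite /P hornerD hornerN hornerZ.
rewrite -PE; have [->|P0] := eqVneq P 0; first by rewrite horner0.
have [k [S Sw PS]] := multiplicity_XsubC P w; move: Sw; rewrite P0 /= => Sw.
have Pw : P.[w] = 0 by rewrite PE /c divfK // subrr.
(* k is the order of contact of the ratio with the constant c at w. *)
have k0 : (0 < k)%N.
  rewrite lt0n; apply: contraNneq Sw => k0.
  by rewrite /root -Pw PS k0 expr0 mulr1.
have Q0 : S.[w] / Q.[w] != 0 by rewrite mulf_neq0 ?invr_eq0.
(* Along the ray of direction u the ratio minus c starts like 'i * t ^ k. *)
pose u := k.-root ('i / (S.[w] / Q.[w])).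
have u0 : 0 < complex.Im (u ^+ k * (S.[w] / Q.[w])).
  by rewrite rootCK // divfK //= ltr01.
have pos := near_ray_Im_gt0 PS qw0 u0.
have /= le := near_ray u cmax.
have [t [] /=] := filter_ex (filterI pos le).
set v := _ + _ => {}pos {}le; have Qv : Q.[v] != 0.
  by apply: contraTneq pos => ->; rewrite invr0 mulr0 ltxx.
have PQ : P.[v] / Q.[v] = horner_complex p v / horner_complex q v - c.
  by rewrite PE mulrBl mulfK.
by move: pos; rewrite PQ raddfB subr_gt0 => /lt_le_trans/(_ le); rewrite ltxx.
Qed.

(** Hopf boundary point lemma. At a real point the leading term of p / q minus
    its value is s (z - x)^k with s real. Its imaginary part is nonpositive in all
    directions of the upper half-plane only when k = 1 and s < 0, and s is then
    the derivative, which is the slope numerator divided by a square. *)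
Lemma slope_num_lt0 p q (x : R) : q.[x] != 0 ->
  (\forall z \near (x%:C : R[i]), 0 < complex.Im z ->
     complex.Im (horner_complex p z / horner_complex q z) <= 0) ->
  p = (p.[x] / q.[x]) *: q \/ slope_num p q x%:C < 0.
Proof.
move=> qx0; set c := _ / _ => fle.
pose P := p - c *: q.
have [P0|P0] := eqVneq P 0; [left|right]; first by apply/eqP; rewrite -subr_eq0 -/P P0.
have [k [S Sx PS]] := multiplicity_XsubC P x; move: Sx; rewrite P0 /= => Sx.
have Px : P.[x] = 0 by rewrite /P hornerD hornerN hornerZ /c divfK // subrr.
have k0 : (0 < k)%N.
  rewrite lt0n; apply: contraNneq Sx => k0.
  by rewrite /root -Px PS k0 expr0 mulr1.
pose PC := map_poly (real_complex R) P.
pose SC := map_poly (real_complex R) S.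
pose QC := map_poly (real_complex R) q.
have PCS : PC = SC * ('X - x%:C%:P) ^+ k.
  by rewrite /PC PS rmorphM rmorphXn rmorphB /= map_polyX map_polyC.
have Qx : QC.[x%:C] != 0 by rewrite horner_map /= fmorph_eq0.
have SQE : SC.[x%:C] / QC.[x%:C] = (S.[x] / q.[x])%:C.
  by rewrite !horner_map /= rmorphM fmorphV.
(* Otherwise the ratio would enter the upper half-plane along this ray. *)
have nodir (u : R[i]) : 0 < complex.Im u ->
    0 < complex.Im (u ^+ k * (S.[x] / q.[x])%:C) -> False.
  move=> u0; rewrite -SQE => uk0; have pos := near_ray_Im_gt0 PCS Qx uk0.
  have /= le := near_ray u fle.
  have [t [t0 []]] := filter_ex (filterI (nbhs_right_gt 0) (filterI pos le)).
  set v := _ + _ => {}pos {}le; have Qv : QC.[v] != 0.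
    by apply: contraTneq pos => ->; rewrite invr0 mulr0 ltxx.
  have PCv : PC.[v] = horner_complex p v - c%:C * horner_complex q v.
    rewrite /PC /P rmorphB /= map_polyZ hornerD hornerN hornerZ //.
  have PQ : PC.[v] / QC.[v] = horner_complex p v / horner_complex q v - c%:C.
    by rewrite PCv mulrBl mulfK.
  move: pos; rewrite PQ raddfB /= subr0 ltNge le //.
  by rewrite /v addrC; case: (u) u0 => a b /= b0; simpc; rewrite /= mulr_gt0.
have SQ0 : S.[x] / q.[x] != 0 by rewrite mulf_neq0 ?invr_eq0.
(* If k > 1, the leading term maps some upper direction to a positive multiple of
   'i, because k-th roots of 'i and - 'i exist in the upper half-plane. *)
case: k k0 PS PCS nodir => // -[_ PS _ nodir|k _ _ _ nodir]; last first.
  exfalso; pose r := S.[x] / q.[x].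
  pose u := k.+2.-root ('i * (Num.sg r)%:C).
  have uE : u ^+ k.+2 = 'i * (Num.sg r)%:C by rewrite rootCK.
  apply: (nodir u); last first.
    by rewrite uE -mulrA -rmorphM /= -/r -normrEsg; simpc => /=; rewrite normr_gt0.
  rewrite lt_neqAle; apply/andP; split; last first.
    by rewrite -lecR complexIm Im_rootC_ge0.
  apply/eqP => /esym/real_Im0 ur; move: uE; rewrite ur -rmorphXn /=.
  by simpc => -[_ /esym/eqP]; rewrite sgr_eq0; apply/negP.
have r0 : S.[x] / q.[x] < 0.
  rewrite ltNge; apply/negP => r0; apply: (nodir 'i); first exact: ltr01.
  by rewrite expr1; simpc => /=; rewrite lt_neqAle eq_sym SQ0.
rewrite slope_num_real.
have -> : p = P + c *: q by rewrite subrK.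
rewrite PS expr1 derivD derivM derivXsubC derivZ !hornerE subrr.
rewrite (_ : _ - _ = S.[x] / q.[x] * q.[x] ^+ 2); last by field.
by rewrite pmulr_llt0 // exprn_even_gt0.
Qed.

End LocalExpansion.

Section MaximumPrinciple.
Variable R : realType.
Implicit Types (p q : {poly R}) (z : R[i]).

(** Maximum principle on the unbounded half-plane region outside a circle: the
    imaginary part vanishes on the real axis because the coefficients are real,
    and the hypothesis at infinity lets the region be truncated. *)
Lemma Im_ratio_max p q (d : R) : 0 < d ->
  (forall z, d <= modulus z -> horner_complex q z != 0) ->
  (forall z, modulus z = d -> 0 <= complex.Im z ->
    complex.Im (horner_complex p z / horner_complex q z) <= 0) ->
  (forall e, 0 < e -> exists M, forall z, M <= modulus z ->
    complex.Im (horner_complex p z / horner_complex q z) <= e) ->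
  forall z, d <= modulus z -> 0 <= complex.Im z ->
    complex.Im (horner_complex p z / horner_complex q z) <= 0.
Proof.
move=> d0 q0 arc infty z1 dz1 z10; set f := fun z =>
  complex.Im (horner_complex p z / horner_complex q z).
rewrite leNgt; apply/negP => fz1.
have e0 : 0 < f z1 / 2 by rewrite divr_gt0.
have [M1 fM1] := infty _ e0.
pose M := Num.max M1 (modulus z1) + 1.
pose A := [set z : R[i] | [/\ d <= modulus z, modulus z <= M & 0 <= complex.Im z]].
have Az1 : A z1.
  split=> //; rewrite /M (@le_trans _ _ (Num.max M1 (modulus z1))) //.
    by rewrite le_max lexx orbT.
  by rewrite lerDl.
have cA : compact A.
  apply: (@compact_complex _ _ M).
    have -> : A = (modulus (R:=R)) @^-1` [set x | d <= x] `&`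
        (modulus (R:=R)) @^-1` [set x | x <= M] `&`
        (@complex.Im R) @^-1` [set x | 0 <= x].
      by apply/seteqP; split=> z /= => [[]|[[]]].
    apply: closedI; first apply: closedI; apply: closed_preimage;
      do ?[exact: continuous_modulus | exact: continuous_Im
          | exact: closed_ge | exact: closed_le].
  move=> z [_ zM _]; split; apply: le_trans zM.
    exact: Re_le_modulus.
  exact: Im_le_modulus.
have cf : {within A, continuous f}.
  apply: continuous_in_subspaceT => z /set_mem[dz _ _].
  apply: (@cvg_Im R _ (nbhs z)).
  exact: (horner_complex_ratio_cvg (q0 z dz)).
(* The maximum is positive, hence is not on the boundary of A. *)
have [c /set_mem[dc cM c0] cmax] := compact_EVT_max (ex_intro _ z1 Az1) cA cf.
have fc : f z1 <= f c by apply: cmax; apply/mem_set.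
have fc0 : 0 < f c by apply: lt_le_trans fc.
have dc' : d < modulus c.
  rewrite lt_neqAle dc andbT; apply: contraTneq fc0 => dE.
  by rewrite -leNgt; apply: arc.
have cM' : modulus c < M.
  rewrite lt_neqAle cM andbT; apply: contraTneq fc => cE; rewrite -ltNge.
  apply: (@le_lt_trans _ _ (f z1 / 2)); last by rewrite ltr_pdivrMr // ltr_pMr // ltr1n.
  apply: fM1; rewrite cE /M (@le_trans _ _ (Num.max M1 (modulus z1))) //.
    by rewrite le_max lexx.
  by rewrite lerDl.
have c0' : 0 < complex.Im c.
  rewrite lt_neqAle c0 andbT eq_sym; apply: contraTneq fc0 => cE.
  by rewrite -leNgt /f Im_ratio cE mul0r.
have nearA : \forall z \near c, A z.
  have H1 := cvgr_gt _ (@continuous_modulus R c) _ dc'.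
  have H2 := cvgr_lt _ (@continuous_modulus R c) _ cM'.
  have H3 := cvgr_gt _ (@continuous_Im R c) _ c0'.
  near=> z; split; apply: ltW; near: z; [exact: H1|exact: H2|exact: H3].
have fmax : \forall z \near c, f z <= f c.
  by apply: filterS nearA => z Az; apply: cmax; apply/mem_set.
(* The ratio is constant, but it is real at the real point d. *)
have /(_ d%:C) := Im_ratio_max_const (q0 _ dc) fmax.
have qd : q.[d] != 0.
  have := q0 d%:C; rewrite modulus_real gtr0_norm // lexx => /(_ isT).
  by rewrite horner_complex_real fmorph_eq0.
rewrite !horner_complex_real => e.
have qdC : (q.[d])%:C != 0 :> R[i] by rewrite fmorph_eq0.
move: fc0; rewrite /f.
have -> : horner_complex p c / horner_complex q c = (p.[d] / q.[d])%:C.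
  by apply: (mulIf qdC); rewrite -e -rmorphM /= divfK.
by rewrite /= ltxx.
Unshelve. all: by end_near. Qed.

End MaximumPrinciple.

(** * Poles and complex differentiability *)

Section PolesAndDerivatives.
Variable R : realType.
Implicit Types (f : ratfun R) (z : R[i]).

Lemma derivable_complex_horner (P : {poly R[i]}) z :
  derivable (fun w : R[i] => P.[w]) z 1.
Proof.
elim/poly_ind: P => [|P c IH].
  rewrite (_ : (fun w : R[i] => _) = cst 0); first exact: derivable_cst.
  by apply/funext => w; rewrite horner0.
rewrite (_ : (fun w : R[i] => _) = (fun w : R[i] => P.[w]) * id + cst c); last first.
  by apply/funext => w; rewrite hornerMXaddC.
apply: derivableD; last exact: derivable_cst.
by apply: derivableM; [exact: IH|exact: derivable_id].
Qed.

Lemma derivable_ratfun_eval f z : ~ pole f z -> derivable (ratfun_eval f) z 1.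
Proof.
move=> /eqP z0; apply: derivableM; first exact: derivable_complex_horner.
by apply: derivableV; [exact: z0|exact: derivable_complex_horner].
Qed.

(** The value at a pole is 0, so differentiability there would make the
    numerator vanish at a root of the denominator, against coprimality. *)
Lemma pole_not_derivable f z : derivable (ratfun_eval f) z 1 -> ~ pole f z.
Proof.
move=> df fz.
have cf : {for z, continuous (ratfun_eval f)}.
  by apply: differentiable_continuous; apply/derivable1_diffP.
have ray : z + t%:C * 1 @[t --> (0 : R)^'+] --> z.
  exact: (cvg_at_right_filter (@continuous_ray R z 1)).
have cfray : ratfun_eval f (z + t%:C * 1) @[t --> (0 : R)^'+] --> (0 : R[i]).
  have -> : (0 : R[i]) = ratfun_eval f z by rewrite /ratfun_eval fz invr0 mulr0.
  exact: (cvg_comp _ _ ray cf).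
have cD : horner_complex (Defs.den f) (z + t%:C * 1) @[t --> (0 : R)^'+] --> (0 : R[i]).
  by rewrite -fz; exact: (cvg_horner_poly ray).
have cN : horner_complex (Defs.num f) (z + t%:C * 1) @[t --> (0 : R)^'+] -->
    horner_complex (Defs.num f) z by exact: (cvg_horner_poly ray).
pose D := map_poly (real_complex R) (Defs.den f).
have D0 : D != 0 by rewrite map_poly_eq0 den_neq0.
have [k [S Sz DS]] := multiplicity_XsubC D z; move: Sz; rewrite D0 /= => Sz.
(* Off z the denominator does not vanish near z, so the numerator is there the
   product of the value, which tends to the value 0 at z, and the denominator. *)
have nearS : \forall t \near (0 : R)^'+, 0 < modulus S.[z + t%:C * 1].
  have cS := cvg_comp _ _ (cvg_horner_poly (P := S) ray) (@continuous_modulus R _).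
  have S0 : 0 < modulus S.[z] by rewrite -ltcR -normE normr_gt0.
  exact: (cvgr_gt _ cS _ S0).
have nearD : \forall t \near (0 : R)^'+, horner_complex (Defs.den f) (z + t%:C * 1) != 0.
  near=> t; rewrite -[horner_complex _ _]/(D.[_]) DS hornerM horner_exp hornerXsubC.
  rewrite addrAC subrr add0r mulr1 mulf_neq0 //; last first.
    by rewrite expf_neq0 // fmorph_eq0 gt_eqF.
  have St : 0 < modulus S.[z + t%:C * 1] by near: t; exact: nearS.
  by apply: contraTneq St; rewrite mulr1 => ->; rewrite modulus_real normr0 ltxx.
have cN0 : horner_complex (Defs.num f) (z + t%:C * 1) @[t --> (0 : R)^'+] --> (0 : R[i]).
  have cM : ratfun_eval f (z + t%:C * 1) * horner_complex (Defs.den f) (z + t%:C * 1)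
      @[t --> (0 : R)^'+] --> (0 * 0 : R[i]) by exact: (cvg_mulC cfray cD).
  rewrite mulr0 in cM; apply: cvg_trans cM; apply: near_eq_cvg; near=> t.
  by rewrite /ratfun_eval divfK //; near: t; exact: nearD.
have Nz : horner_complex (Defs.num f) z = 0.
  exact: (cvg_unique (@norm_hausdorff _ R[i]) cN cN0).
have /coprimep_root : coprimep (map_poly (real_complex R) (Defs.num f)) D.
  by rewrite coprimep_map coprimep_num_den.
by move=> /(_ z)/(_ (introT eqP Nz)); rewrite -[D.[z]]/(horner_complex _ _) fz eqxx.
Unshelve. all: by end_near. Qed.

End PolesAndDerivatives.

(** * Real quadratic forms *)

Section RealForms.
Variables (R : realType) (m : nat).
Implicit Types (S : 'M[R]_m) (a b : 'rV[R]_m).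
Local Notation toC := (map_mx (real_complex R)).

Definition form S a : R := (a *m S *m a^T) 0 0.

Lemma formE S a : form S a = \sum_i \sum_j a 0 i * a 0 j * S i j.
Proof.
rewrite /form mxE exchange_big /=; apply: eq_bigr => j _.
rewrite mxE big_distrl /=; apply: eq_bigr => i _.
by rewrite !mxE; ring.
Qed.

Lemma hermsymmx_toC S : S^T = S -> toC S \is hermsymmx.
Proof.
move=> Ssym; apply/is_hermitianmxP; rewrite expr0 scale1r.
apply/matrixP => i j; rewrite !mxE -{1}Ssym mxE.
by rewrite -[RHS]/(((S j i)%:C)^*)%C conjc_real.
Qed.

(** For a real symmetric matrix the cross terms between the real and imaginary
    parts of the vector cancel, so real vectors suffice to test definiteness. *)
Lemma hermitian_form_toC S (v : 'cV[R[i]]_m) : S^T = S ->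
  (map_mx Num.conj v^T *m toC S *m v) 0 0 =
  (form S (map_mx (@complex.Re R) v^T) + form S (map_mx (@complex.Im R) v^T))%:C.
Proof.
move=> Ssym; set x := map_mx _ v^T; set y := map_mx (@complex.Im R) v^T.
have vE : v = toC x^T + 'i *: toC y^T.
  by apply/matrixP => i j; rewrite !mxE; apply: complexE.
have cvE : map_mx Num.conj v^T = toC x - 'i *: toC y.
  apply/matrixP => i j; rewrite !mxE -[LHS]/((v j i)^*)%C.
  by case: (v j i) => p q; simpc.
have yx : y *m S *m x^T = x *m S *m y^T.
  have <- : (y *m S *m x^T)^T = x *m S *m y^T.
    by rewrite 2!trmx_mul trmxK Ssym mulmxA.
  by apply/matrixP => i j; rewrite !ord1 [RHS]mxE.
rewrite cvE vE /form rmorphD /= !mulmxDr !mulmxBl.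
rewrite -!scalemxAr -!scalemxAl -!map_mxM yx !mxE.
by rewrite !mulrA -expr2 sqr_i; ring.
Qed.

Lemma form0 S : form S 0 = 0.
Proof. by rewrite /form !mul0mx mxE. Qed.

Lemma form_scale S a (c : R) : form (c *: S) a = c * form S a.
Proof. by rewrite /form -scalemxAr -scalemxAl mxE. Qed.

Lemma Re_toC a : map_mx (@complex.Re R) (toC a) = a.
Proof. by apply/matrixP => i j; rewrite !mxE. Qed.

Lemma Im_toC a : map_mx (@complex.Im R) (toC a) = 0.
Proof. by apply/matrixP => i j; rewrite !mxE. Qed.

Lemma posdef_toC S : S^T = S ->
  posdef (toC S) <-> forall a, a != 0 -> 0 < form S a.
Proof.
move=> Ssym; split=> [[_ pos] a a0|pos].
  have := pos (toC a)^T; rewrite hermitian_form_toC // trmxK Re_toC Im_toC.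
  rewrite form0 addr0 ltcR; apply; apply: contra a0 => /eqP/(congr1 trmx).
  rewrite trmxK trmx0 => /matrixP a0; apply/eqP/matrixP => i j.
  by have := a0 i j; rewrite !mxE => -[].
split=> [|v v0]; first exact: hermsymmx_toC.
rewrite hermitian_form_toC // ltcR.
set x := map_mx _ v^T; set y := map_mx (@complex.Im R) v^T.
have ge0 a : 0 <= form S a.
  by have [->|/pos/ltW//] := eqVneq a 0; rewrite form0.
have [x0|/pos x0] := eqVneq x 0; last by rewrite ltr_wpDr.
have [y0|/pos y0] := eqVneq y 0; last by rewrite ltr_wpDl.
case/eqP: v0; apply/matrixP => i j.
move/matrixP/(_ j i): x0; move/matrixP/(_ j i): y0; rewrite !mxE.
by case: (v i j) => p q /= -> ->.
Qed.

Lemma possemidef_toC S : S^T = S ->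
  possemidef (toC S) <-> forall a, 0 <= form S a.
Proof.
move=> Ssym; split=> [[_ pos] a|pos].
  have := pos (toC a)^T; rewrite hermitian_form_toC // trmxK Re_toC Im_toC.
  by rewrite form0 addr0 lecR.
split=> [|v]; first exact: hermsymmx_toC.
by rewrite hermitian_form_toC // lecR addr_ge0.
Qed.

(** Otherwise perturbing a in a direction not orthogonal to its image would
    make the form negative at first order. *)
Lemma psd_kernel S a : S^T = S -> (forall b, 0 <= form S b) -> form S a = 0 ->
  a *m S = 0.
Proof.
move=> Ssym psd a0; apply/rowP => i; rewrite [RHS]mxE.
pose e := delta_mx 0 i : 'rV[R]_m.
pose x := (a *m S) 0 i; pose y := form S e.
have xE : (a *m S *m e^T) 0 0 = x.
  rewrite mxE (bigD1 i) //= big1 ?addr0 => [|j ji].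
    by rewrite [e^T _ _]mxE [e _ _]mxE !eqxx mulr1.
  by rewrite [e^T _ _]mxE [e _ _]mxE eqxx (negPf ji) mulr0.
have xE' : (e *m S *m a^T) 0 0 = x.
  rewrite -xE; have <- : (e *m S *m a^T)^T = a *m S *m e^T.
    by rewrite 2!trmx_mul trmxK Ssym mulmxA.
  by rewrite [RHS]mxE.
have D00 (A B : 'M[R]_1) : (A + B) 0 0 = A 0 0 + B 0 0 by rewrite mxE.
have Z00 (c : R) (A : 'M[R]_1) : (c *: A) 0 0 = c * A 0 0 by rewrite mxE.
have pos s : 0 <= 2 * s * x + s ^+ 2 * y.
  have := psd (a + s *: e); rewrite /form linearD linearZ /=.
  rewrite !mulmxDl !mulmxDr -!scalemxAl -!scalemxAr.
  rewrite !D00 !Z00 xE xE' -/(form S a) a0 -/(form S e) -/y.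
  by rewrite (_ : _ + _ = 2 * s * x + s ^+ 2 * y) //; ring.
apply/eqP; rewrite -/x; apply: contraT => x0.
have y0 : 0 <= y by apply: psd.
(* At this s the linear term outweighs the quadratic one; adding 1 to y avoids
   a division by zero. *)
have := pos (- x / (y + 1)); rewrite leNgt => /negP[].
have y1 : 0 < y + 1 by lra.
rewrite (_ : _ + _ = - (x ^+ 2 * (y + 2) / (y + 1) ^+ 2)); last first.
  by field; rewrite gt_eqF.
rewrite oppr_lt0 mulr_gt0 ?invr_gt0 ?exprn_gt0 // mulr_gt0 ?exprn_even_gt0 //.
by lra.
Qed.

End RealForms.

Lemma cvg_mx (T : Type) (F : set_system T) (FF : Filter F) (U : topologicalType)
    m n (f : T -> 'M[U]_(m, n)) (M : 'M[U]_(m, n)) :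
  (forall i j, f x i j @[x --> F] --> M i j) -> f @ F --> M.
Proof.
move=> fM A [P MP PA].
have : \forall x \near F, forall ij : 'I_m * 'I_n, P ij.1 ij.2 (f x ij.1 ij.2).
  by apply: filter_forall => ij; apply: fM.
by apply: filterS => x fP; apply: PA => i j; apply: (fP (i, j)).
Qed.

Section NegativeImaginaryForm.
Variables (R : realType) (m : nat) (G : tf R m).
Hypothesis G_sym : symmetric_tf G.
Implicit Types (a b : 'rV[R]_m) (z : R[i]).
Local Notation toC := (map_mx (real_complex R)).

(** For symmetric G this is i [G(z) - G(z)^*], read as a real matrix. *)
Definition ni_real z : 'M[R]_m := map_mx (fun c => - 2 * complex.Im c) (tf_eval G z).

Lemma tf_eval_sym z : (tf_eval G z)^T = tf_eval G z.
Proof.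
apply/matrixP => i j; rewrite !mxE.
by have := congr1 (fun A : 'M[_]_m => A i j) G_sym; rewrite mxE => ->.
Qed.

Lemma ni_real_sym z : (ni_real z)^T = ni_real z.
Proof.
apply/matrixP => i j; rewrite !mxE.
by have := congr1 (fun A : 'M[_]_m => A i j) (tf_eval_sym z); rewrite !mxE => ->.
Qed.

Lemma ni_formE z : ni_form (tf_eval G z) = toC (ni_real z).
Proof.
apply/matrixP => i j; rewrite [in LHS]/ni_form.
have e := congr1 (fun A : 'M[_]_m => A i j) (tf_eval_sym z).
move: e; rewrite !mxE => ->.
rewrite -[Num.conj _]/((_)^*)%C.
case: (ratfun_eval _ _) => p q; simpc => /=.
congr (_ +i* _); ring.
Qed.

(** a^T G(z) a is the scalar real rational function [form_num a] / [tf_den G];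
    the whole theorem is reduced to these functions. *)
Definition form_num a : {poly R} := \sum_i \sum_j (a 0 i * a 0 j) *: tf_num G i j.

(** i [G(z) - G(z)^*] / Im z, extended continuously to the real axis. *)
Definition ni_slope z : 'M[R]_m := \matrix_(i, j) (- 2 *
  (slope_num (tf_num G i j) (tf_den G) z /
   (complex.Re (horner_complex (tf_den G) z) ^+ 2 +
    complex.Im (horner_complex (tf_den G) z) ^+ 2))).

Lemma slope_sym z : (ni_slope z)^T = ni_slope z.
Proof.
apply/matrixP => i j; rewrite mxE [LHS]mxE [RHS]mxE.
have e : (tf_num G)^T i j = tf_num G i j by rewrite tf_num_sym.
by move: e; rewrite [LHS]mxE => ->.
Qed.

Lemma ni_real_slope z : horner_complex (tf_den G) z != 0 ->
  ni_real z = complex.Im z *: ni_slope z.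
Proof.
move=> z0; apply/matrixP => i j.
rewrite [LHS]mxE tf_evalE // Im_ratio [RHS]mxE [X in _ = _ * X]mxE.
by rewrite mulrCA.
Qed.

Lemma slope_num_form a z : slope_num (form_num a) (tf_den G) z =
  \sum_i \sum_j a 0 i * a 0 j * slope_num (tf_num G i j) (tf_den G) z.
Proof.
pose f p := slope_num p (tf_den G) z.
have f0 : f 0 = 0 by rewrite /f slope_num0.
have fD : {morph f : p q / p + q} by move=> p q; rewrite /f slope_numD.
rewrite -[LHS]/(f _) (big_morph f fD f0); apply: eq_bigr => i _.
rewrite (big_morph f fD f0); apply: eq_bigr => j _.
by rewrite /f slope_numZ.
Qed.

Lemma slope_num_scale (c : R) a z :
  slope_num (form_num (c *: a)) (tf_den G) z = c ^+ 2 * slope_num (form_num a) (tf_den G) z.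
Proof.
rewrite !slope_num_form mulr_sumr; apply: eq_bigr => i _.
by rewrite mulr_sumr; apply: eq_bigr => j _; rewrite !mxE; ring.
Qed.

Lemma form_slope a z : form (ni_slope z) a =
  - 2 * (slope_num (form_num a) (tf_den G) z /
   (complex.Re (horner_complex (tf_den G) z) ^+ 2 +
    complex.Im (horner_complex (tf_den G) z) ^+ 2)).
Proof.
rewrite formE slope_num_form mulr_suml mulr_sumr; apply: eq_bigr => i _.
rewrite mulr_suml mulr_sumr; apply: eq_bigr => j _.
by rewrite [ni_slope z i j]mxE; ring.
Qed.

Lemma form_slope_gt0 a z : horner_complex (tf_den G) z != 0 ->
  (0 < form (ni_slope z) a) = (slope_num (form_num a) (tf_den G) z < 0).
Proof.
move=> /Re2Im2_gt0 d0; rewrite form_slope mulNr oppr_gt0 pmulr_rlt0 //.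
by rewrite pmulr_llt0 ?invr_gt0.
Qed.

Lemma form_ni_real a z : horner_complex (tf_den G) z != 0 ->
  form (ni_real z) a = - 2 *
  complex.Im (horner_complex (form_num a) z / horner_complex (tf_den G) z).
Proof.
by move=> z0; rewrite ni_real_slope // form_scale form_slope Im_ratio; ring.
Qed.

Lemma ni_real_row a z i : horner_complex (tf_den G) z != 0 ->
  (a *m ni_real z) 0 i = - 2 *
  complex.Im (horner_complex (\sum_j a 0 j *: tf_num G j i) z /
    horner_complex (tf_den G) z).
Proof.
move=> z0; rewrite mxE horner_complex_sum mulr_suml.
rewrite (big_morph (@complex.Im R) (raddfD _) (raddf0 _)) mulr_sumr.
apply: eq_bigr => j _; rewrite [ni_real _ _ _]mxE tf_evalE //.
by rewrite horner_complexZ -mulrA Im_realM; ring.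
Qed.

End NegativeImaginaryForm.

(** * Conditions on the unit circle *)

Section BoundaryLimits.
Variables (R : realType) (m : nat) (G : tf R m).
Hypothesis G_sym : symmetric_tf G.
Implicit Types (a b : 'rV[R]_m) (z : R[i]).
Local Notation toC := (map_mx (real_complex R)).

Lemma continuous_expi : continuous (@expi R).
Proof.
move=> t; apply: (@cvg_comp _ _ _ (fun x : R => (cos x, sin x))
  (fun u : R * R => u.1 +i* u.2) (nbhs t) (nbhs (cos t, sin t))).
  apply: (@cvg_pair _ _ _ (nbhs t) (nbhs (cos t)) (nbhs (sin t))).
    exact: continuous_cos.
  exact: continuous_sin.
exact: (@continuous_complex_pair R (cos t, sin t)).
Qed.

Lemma modulus_expi (t : R) : modulus (expi t) = 1.
Proof. by rewrite /modulus normc_def /= cos2Dsin2 sqrtr1. Qed.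

Lemma slope_cvg i j z : horner_complex (tf_den G) z != 0 ->
  ni_slope G w i j @[w --> z] --> ni_slope G z i j.
Proof.
move=> z0.
have sE w : ni_slope G w i j = - 2 *
  (slope_num (tf_num G i j) (tf_den G) w /
   (complex.Re (horner_complex (tf_den G) w) ^+ 2 +
    complex.Im (horner_complex (tf_den G) w) ^+ 2)) by rewrite mxE.
under eq_fun do rewrite sE.
rewrite sE.
have cD := @continuous_horner_complex R (tf_den G) z.
have cRe := @cvg_Re R _ (nbhs z) _ _ cD.
have cIm := @cvg_Im R _ (nbhs z) _ _ cD.
apply: (@cvgM R _ (nbhs z)); first exact: (@cvg_cst R _ _ (nbhs z)).
apply: (@cvgM R _ (nbhs z)); first exact: continuous_slope_num.
apply: (@cvgV R _ (nbhs z)); first by rewrite gt_eqF // Re2Im2_gt0.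
by apply: (@cvgD R R _ (nbhs z)); apply: (@cvgM R _ (nbhs z)).
Qed.

(** As Im (expi t) = sin t, the quotient is the slope matrix, which is
    continuous up to the real axis; this covers both end points. *)
Lemma boundary_limit (F : set_system R) (FF : ProperFilter F) (t0 : R) :
  F --> t0 -> (\forall t \near F, sin t != 0) ->
  horner_complex (tf_den G) (expi t0) != 0 ->
  ((sin t)^-1)%:C *: ni_form (tf_eval G (expi t)) @[t --> F] -->
  toC (ni_slope G (expi t0)).
Proof.
move=> Ft0 sin0 den0; apply: cvg_mx => i j.
have cexp : expi t @[t --> F] --> expi t0.
  exact: (cvg_comp _ _ Ft0 (@continuous_expi t0)).
have cs : (ni_slope G (expi t) i j)%:C @[t --> F] --> (ni_slope G (expi t0) i j)%:C.
  apply: cvg_real_complex; exact: (cvg_comp _ _ cexp (slope_cvg (i := i) (j := j) den0)).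
rewrite mxE; apply: cvg_trans cs; apply: near_eq_cvg.
have nearD : \forall t \near F, horner_complex (tf_den G) (expi t) != 0.
  have cD := cvg_comp _ _ (cvg_comp _ _ cexp (@continuous_horner_complex R (tf_den G) _))
    (@continuous_modulus R _).
  have D0 : 0 < modulus (horner_complex (tf_den G) (expi t0)).
    by rewrite -ltcR -normE normr_gt0.
  apply: filterS (cvgr_gt _ cD _ D0) => t.
  by apply: contraTneq => /= ->; rewrite modulus_real normr0 ltxx.
apply: filterS2 nearD sin0 => t Dt st.
rewrite ni_formE // ni_real_slope // [RHS]mxE [X in _ = _ * X]mxE [X in _ = _ * X%:C]mxE /=.
by rewrite -rmorphM /= mulKf.
Qed.

Lemma posdef_boundary_limit (F : set_system R) (FF : ProperFilter F) (t0 : R) :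
  F --> t0 -> (\forall t \near F, sin t != 0) ->
  horner_complex (tf_den G) (expi t0) != 0 ->
  (exists2 Q : 'M[R[i]]_m,
     ((sin t)^-1)%:C *: ni_form (tf_eval G (expi t)) @[t --> F] --> Q & posdef Q) <->
  forall a, a != 0 -> slope_num (form_num G a) (tf_den G) (expi t0) < 0.
Proof.
move=> Ft0 sin0 den0; have lim := boundary_limit FF Ft0 sin0 den0.
have posE : posdef (toC (ni_slope G (expi t0))) <->
    forall a, a != 0 -> slope_num (form_num G a) (tf_den G) (expi t0) < 0.
  rewrite posdef_toC ?slope_sym //; split=> pos a a0.
    by rewrite -form_slope_gt0 // pos.
  by rewrite form_slope_gt0 // pos.
rewrite -posE; split=> [[Q Qlim Qpos]|]; last by exists (toC (ni_slope G (expi t0))).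
suff <- : Q = toC (ni_slope G (expi t0)) by [].
apply/matrixP => i j.
have coord (M : 'M[R[i]]_m) :
  ((sin t)^-1)%:C *: ni_form (tf_eval G (expi t)) @[t --> F] --> M ->
  (((sin t)^-1)%:C *: ni_form (tf_eval G (expi t))) i j @[t --> F] --> M i j.
  by move=> cM; exact: (cvg_comp _ _ cM (@coord_continuous _ _ _ i j M)).
exact: (cvg_unique (@norm_hausdorff _ R[i]) (coord _ Qlim) (coord _ lim)).
Qed.

Lemma posdef_ni_form z : 0 < complex.Im z -> horner_complex (tf_den G) z != 0 ->
  posdef (ni_form (tf_eval G z)) <->
  forall a, a != 0 -> slope_num (form_num G a) (tf_den G) z < 0.
Proof.
move=> z0 den0; rewrite ni_formE // posdef_toC ?ni_real_sym //.
split=> pos a a0.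
  have := pos a a0; rewrite ni_real_slope // form_scale pmulr_rgt0 //.
  by rewrite form_slope_gt0.
by rewrite ni_real_slope // form_scale pmulr_rgt0 // form_slope_gt0 // pos.
Qed.

Lemma expi0 : expi 0 = (1 : R)%:C.
Proof. by rewrite /expi cos0 sin0. Qed.

Lemma expi_pi : expi pi = (- 1 : R)%:C.
Proof. by rewrite /expi cospi sinpi. Qed.

Lemma upper_circle_expi z : modulus z = 1 -> 0 < complex.Im z ->
  exists2 t : R, 0 < t < pi & z = expi t.
Proof.
case: z => x y z1 /= y0.
have xy : x ^+ 2 + y ^+ 2 = 1.
  apply: complexI; rewrite -[LHS](normc_sqr (x +i* y)) normE z1.
  by rewrite expr1n.
have y2 : 0 < y ^+ 2 by rewrite exprn_gt0.
have xlt1 : x < 1 by nra.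
have xgtN1 : - 1 < x by nra.
have xle : - 1 <= x <= 1 by rewrite !ltW.
exists (acos x); first by rewrite acos_gt0 ?acos_ltpi ?xgtN1 ?xlt1 ?ltW.
rewrite /expi acosK ?in_itv //= sin_acos //; congr (_ +i* _).
by rewrite -xy addrC addKr sqrtr_sqr gtr0_norm.
Qed.

(** The open arc and the two limits together are one pointwise condition on the
    circle, the lower half being obtained by conjugation. *)
Lemma boundary_conditionsP :
  (forall z, 1 <= modulus z -> horner_complex (tf_den G) z != 0) ->
  [/\ forall t : R, 0 < t < pi -> posdef (ni_form (tf_eval G (expi t))),
      exists2 Q0 : 'M[R[i]]_m,
        ((sin t)^-1)%:C *: ni_form (tf_eval G (expi t)) @[t --> 0^'+] --> Q0
        & posdef Q0
    & exists2 Qpi : 'M[R[i]]_m,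
        ((sin t)^-1)%:C *: ni_form (tf_eval G (expi t)) @[t --> pi^'-] --> Qpi
        & posdef Qpi] <->
  forall z a, modulus z = 1 -> a != 0 ->
    slope_num (form_num G a) (tf_den G) z < 0.
Proof.
move=> den0.
have den_expi t : horner_complex (tf_den G) (expi t) != 0.
  by apply: den0; rewrite modulus_expi.
have pi0 : 0 < pi :> R := pi_gt0 R.
have sin0 : \forall t \near (0 : R)^'+, sin t != 0.
  by near=> t; rewrite gt_eqF // sin_gt0_pi //; apply/andP; split.
have sinpi : \forall t \near (pi : R)^'-, sin t != 0.
  by near=> t; rewrite gt_eqF // sin_gt0_pi //; apply/andP; split.
have c0 : (0 : R)^'+ --> (0 : R) by exact: cvg_within.
have cpi : (pi : R)^'- --> (pi : R) by exact: cvg_within.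
have lim0 := posdef_boundary_limit _ c0 sin0 (den_expi 0).
have limpi := posdef_boundary_limit _ cpi sinpi (den_expi pi).
rewrite expi0 in lim0; rewrite expi_pi in limpi.
have up t : 0 < t < pi -> posdef (ni_form (tf_eval G (expi t))) <->
    forall a, a != 0 -> slope_num (form_num G a) (tf_den G) (expi t) < 0.
  by move=> t0; apply: posdef_ni_form => //=; apply: sin_gt0_pi.
split=> [[pos /lim0 pos0 /limpi pospi] z a z1 a0|neg]; last first.
  split=> [t t0||]; last 2 first.
  - by apply/lim0 => a a0; apply: neg => //; rewrite modulus_real normr1.
  - by apply/limpi => a a0; apply: neg => //; rewrite modulus_real normrN1.
  by apply/up => // a a0; apply: neg => //; apply: modulus_expi.
have [z0|z0|z0] := ltgtP (complex.Im z) 0.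
- have := @upper_circle_expi (z^*); rewrite modulus_conj => /(_ z1).
  case=> [|t t0 zt]; first by case: (z) z0 => x y /=; rewrite oppr_gt0.
  by rewrite -slope_num_conj zt; apply: (up t t0).1 => //; apply: pos.
- have [t t0 ->] := upper_circle_expi z1 z0.
  by apply: (up t t0).1 => //; apply: pos.
rewrite (real_Im0 z0); move: z1; rewrite (real_Im0 z0) modulus_real.
move=> /eqP; rewrite eqr_norml => /andP[/orP[]/eqP -> _]; [exact: pos0|exact: pospi].
Unshelve. all: by end_near. Qed.

End BoundaryLimits.

(** * From strong strict negative imaginariness to the circle *)

Section Forward.
Variables (R : realType) (m : nat) (G : tf R m).
Hypothesis G_sym : symmetric_tf G.
Implicit Types (a b : 'rV[R]_m) (z w : R[i]).
Local Notation toC := (map_mx (real_complex R)).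
Local Notation Q := (tf_den G).
Local Notation f a := (fun z => horner_complex (form_num G a) z / horner_complex Q z).

Lemma DNI_dilate_region (d : R) : 0 < d -> DNI (tf_dilate d G) ->
  (forall w, d < modulus w -> horner_complex Q w != 0) /\
  (forall w a, d < modulus w -> 0 < complex.Im w -> complex.Im (f a w) <= 0).
Proof.
move=> d0 [an ni].
have region w : d < modulus w ->
    exists z, [/\ 1 < `|z|, w = d%:C * z & 0 < complex.Im w -> 0 < complex.Im z].
  move=> dw; exists ((d^-1)%:C * w); split.
  - rewrite -[1]/(1%:C) gt_modulus modulusM modulus_real gtr0_norm ?invr_gt0 //.
    by rewrite mulrC ltr_pdivlMr // mul1r.
  - by rewrite mulrA -rmorphM /= mulfV ?gt_eqF // mul1r.
  - by move=> w0; rewrite Im_realM mulr_gt0 ?invr_gt0.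
have den0 w : d < modulus w -> horner_complex Q w != 0.
  move=> /region[z [z1 -> _]]; apply/eqP => /tf_poleE[i [j]].
  have := an z z1 i j.
  rewrite (_ : (fun w => _) = ratfun_eval (ratfun_dilate d (G i j))); last first.
    by apply/funext => x; rewrite !mxE.
  by move=> /pole_not_derivable np /(pole_dilate _ _ (lt0r_neq0 d0)).
split=> // w a dw w0; have Qw := den0 w dw.
have [z [z1 wE /(_ w0) z0]] := region w dw.
have [/(_ z0) + _ _] := ni z z1; rewrite tf_eval_dilate ?gt_eqF // -wE ni_formE //.
rewrite possemidef_toC ?ni_real_sym // => /(_ a).
by rewrite form_ni_real //; lra.
Qed.

(** If a^T G a were real at one point of the upper region, it would be constant
    by the maximum principle; then a is in the kernel of Im G there, so G a is
    itself constant, and a is in the kernel of G(z) - G(1/z)^T for every z,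
    against the full rank. *)
Lemma Im_form_lt0 (d : R) : d < 1 ->
  (forall w, d < modulus w -> horner_complex Q w != 0) ->
  (forall w a, d < modulus w -> 0 < complex.Im w -> complex.Im (f a w) <= 0) ->
  full_normal_rank (reciprocal_domain G)
    (fun z => 'i *: (tf_eval G z - (tf_eval G z^-1)^T)) ->
  forall w a, d < modulus w -> 0 < complex.Im w -> a != 0 -> complex.Im (f a w) < 0.
Proof.
move=> d1 den0 le0 [z0 [_ nz nzi] detz] w a dw w0 a0; rewrite lt_neqAle le0 // andbT.
apply/negP => /eqP fw0.
have near_region : \forall w' \near w, d < modulus w' /\ 0 < complex.Im w'.
  have H1 := cvgr_gt _ (@continuous_modulus R w) _ dw.
  have H2 := cvgr_gt _ (@continuous_Im R w) _ w0.
  by near=> w'; split; near: w'; [exact: H1|exact: H2].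
have fmax : \forall v \near w, complex.Im (f a v) <= complex.Im (f a w).
  rewrite fw0; near=> v; have [dv v0] : d < modulus v /\ 0 < complex.Im v.
    by near: v; exact: near_region.
  exact: le0.
have fconst w' : d < modulus w' -> complex.Im (f a w') = 0.
  by move=> dw'; rewrite (Im_ratio_max_const (den0 w dw) fmax) mulfK ?den0.
have row0 w' : d < modulus w' -> 0 < complex.Im w' -> a *m ni_real G w' = 0.
  move=> dw' w0'; apply: psd_kernel; first exact: ni_real_sym.
    by move=> b; rewrite form_ni_real ?den0 //; have := le0 w' b dw' w0'; lra.
  by rewrite form_ni_real ?den0 // fconst // mulr0.
(* (G a)_i is g i / Q: it is real on the region, hence constant. *)
pose g i : {poly R} := \sum_j a 0 j *: tf_num G j i.
have g0 i w' : d < modulus w' -> 0 < complex.Im w' ->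
    complex.Im (horner_complex (g i) w' / horner_complex Q w') = 0.
  move=> dw' w0'; have := row0 w' dw' w0'.
  move=> /(congr1 (fun v : 'rV[R]_m => v 0 i)).
  by rewrite ni_real_row ?den0 // mxE; rewrite -/(g i); lra.
have gmax i : \forall v \near w,
    complex.Im (horner_complex (g i) v / horner_complex Q v) <=
    complex.Im (horner_complex (g i) w / horner_complex Q w).
  near=> v; have [dv v0] : d < modulus v /\ 0 < complex.Im v.
    by near: v; exact: near_region.
  by rewrite !g0.
have gconst i := Im_ratio_max_const (den0 w dw) (gmax i).
have rowG i z : ~ tf_pole G z ->
    (toC a *m tf_eval G z) 0 i = horner_complex (g i) w / horner_complex Q w.
  move=> /tf_poleE/eqP Qz; rewrite mxE.
  transitivity (horner_complex (g i) z / horner_complex Q z).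
    rewrite /g horner_complex_sum mulr_suml.
    by apply: eq_bigr => j _; rewrite horner_complexZ mxE tf_evalE // mulrA.
  by rewrite [horner_complex (g i) z]gconst mulfK.
case/eqP: detz; apply/eqP/det0P; exists (toC a).
  apply: contra a0 => /eqP/matrixP e; apply/eqP/matrixP => i j.
  by have := e i j; rewrite !mxE => -[].
rewrite -scalemxAr mulmxBr tf_eval_sym //.
rewrite (_ : _ - _ = 0) ?scaler0 //; apply/rowP => i.
by rewrite mxE [X in _ + X]mxE !rowG // subrr mxE.
Unshelve. all: by end_near. Qed.

(** On the arc this is the strict inequality above; at 1 and -1 it is the
    boundary point lemma, as a^T G a is not constant. *)
Lemma DSSNI_circle : DSSNI G ->
  (forall z, 1 <= modulus z -> horner_complex Q z != 0) /\
  (forall z a, modulus z = 1 -> a != 0 -> slope_num (form_num G a) Q z < 0).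
Proof.
move=> [[d /andP[d0 d1] /(DNI_dilate_region d0)[den0 le0]] rank].
have lt0 := Im_form_lt0 d1 den0 le0 rank.
split=> [z z1|z a z1 a0]; first by apply: den0; apply: lt_le_trans z1.
have up v : modulus v = 1 -> 0 < complex.Im v -> slope_num (form_num G a) Q v < 0.
  move=> v1 v0; have dv : d < modulus v by rewrite v1.
  have := lt0 v a dv v0 a0; rewrite Im_ratio pmulr_rlt0 // pmulr_llt0 //.
  by rewrite invr_gt0 Re2Im2_gt0 ?den0.
have [z0|z0|z0] := ltgtP (complex.Im z) 0.
- rewrite -slope_num_conj; apply: up; first by rewrite modulus_conj.
  by case: (z) z0 => x y /=; rewrite oppr_gt0.
- exact: up.
have dz : d < modulus z by rewrite z1.
move: (dz); rewrite (real_Im0 z0); set x := complex.Re z => dx.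
have qx : Q.[x] != 0.
  by have := den0 _ dx; rewrite horner_complex_real fmorph_eq0.
have [|c_eq|//] := @slope_num_lt0 R (form_num G a) Q x qx.
  have H1 := cvgr_gt _ (@continuous_modulus R x%:C) _ dx.
  near=> v => v0; apply: le0 => //.
  by near: v; exact: H1.
have di : d < modulus ('i : R[i]) by rewrite modulus_i.
have := lt0 'i a di ltr01 a0; rewrite c_eq horner_complexZ mulfK ?den0 //.
by rewrite /= ltxx.
Unshelve. all: by end_near. Qed.

End Forward.

(** * From the circle to strong strict negative imaginariness *)

Section Backward.
Variables (R : realType) (m : nat) (G : tf R m).
Hypotheses (G_sym : symmetric_tf G) (G_proper : proper_tf G).
Implicit Types (a b : 'rV[R]_m) (z w : R[i]).
Local Notation toC := (map_mx (real_complex R)).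
Local Notation Q := (tf_den G).
Local Notation f a := (fun z => horner_complex (form_num G a) z / horner_complex Q z).

(** The compact faces together meet every line through the origin, so that,
    forms being homogeneous, they can replace the unit sphere. *)
Definition face (j : 'I_m) : set 'rV[R]_m :=
  [set a | forall i, (if i == j then [set 1] else `[(- 1), 1]%classic) (a 0 i)].

Lemma compact_face j : compact (face j).
Proof.
apply: (@rV_compact R m (fun i => if i == j then [set 1] else `[(- 1), 1]%classic)).
move=> i; case: ifP => _; first exact: compact_set1.
exact: segment_compact.
Qed.

Lemma scale_to_face a : a != 0 ->
  exists j, a 0 j != 0 /\ face j ((a 0 j)^-1 *: a).
Proof.
move=> a0; have [i0 ai0] : exists i, a 0 i != 0.
  apply/existsP; apply: contraNT a0 => /existsPn a0; apply/eqP/rowP => i.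
  by have := a0 i; rewrite negbK mxE => /eqP.
case: (@arg_maxP _ _ _ i0 predT (fun i => `|a 0 i|) isT) => j _ jmax.
have aj : a 0 j != 0.
  by rewrite -normr_gt0; apply: lt_le_trans (jmax i0 isT); rewrite normr_gt0.
exists j; split=> // i; rewrite mxE; case: eqP => [->|_].
  by rewrite mulVf.
rewrite /= in_itv /= -ler_norml normrM normfV mulrC.
by rewrite ler_pdivrMr ?normr_gt0 // mul1r; apply: jmax.
Qed.

Lemma continuous_slope_form :
  continuous (fun u : R[i] * 'rV[R]_m => slope_num (form_num G u.2) Q u.1).
Proof.
move=> u; under eq_fun do rewrite slope_num_form.
have c1 : v.1 @[v --> u] --> u.1 by exact: cvg_fst.
have c2 (i : 'I_m) : (fun v : R[i] * 'rV[R]_m => v.2 0 i) @ u --> u.2 0 i.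
  have c2 : v.2 @[v --> u] --> u.2 by exact: cvg_snd.
  exact: (cvg_comp _ _ c2 (@coord_continuous _ _ _ 0 i u.2)).
apply: (@cvg_big R _ _ _ _ (@add_continuous R) _ (nbhs u)) => i _.
apply: (@cvg_big R _ _ _ _ (@add_continuous R) _ (nbhs u)) => j _.
apply: (@cvgM R _ (nbhs u)).
  by apply: (@cvgM R _ (nbhs u)); apply: c2.
exact: (cvg_comp _ _ c1 (@continuous_slope_num R (tf_num G i j) Q u.1)).
Qed.

Hypothesis den0 : forall z, 1 <= modulus z -> horner_complex Q z != 0.
Hypothesis slope_lt0 :
  forall z a, modulus z = 1 -> a != 0 -> slope_num (form_num G a) Q z < 0.

(** By compactness of the circle and of the faces, the strict inequalities and
    the absence of poles extend to slightly smaller circles. *)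
Lemma smaller_circle : exists d : R, [/\ 0 < d < 1,
  forall z, d <= modulus z -> horner_complex Q z != 0 &
  forall z a, modulus z = d -> a != 0 -> slope_num (form_num G a) Q z < 0].
Proof.
have near_slope : \forall r \near (1 : R), forall j z a, modulus z = 1 -> face j a ->
    slope_num (form_num G a) Q (r%:C * z) < 0.
  apply: (@filter_forall _ _ (fun j r => forall z a, modulus z = 1 -> face j a ->
    slope_num (form_num G a) Q (r%:C * z) < 0) (nbhs (1 : R))) => j.
  have lt0 z a : modulus z = 1 -> face j a ->
      (fun u : R[i] * 'rV[R]_m => slope_num (form_num G u.2) Q u.1) (z, a) < 0.
    move=> z1 ja /=.
    apply: slope_lt0 => //; apply/eqP => a0; have := ja j; rewrite eqxx a0 mxE /=.
    by move/eqP; rewrite eq_sym oner_eq0.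
  exact: (near_circle_lt0 (compact_face (j := j)) continuous_slope_form lt0).
(* The parameter ranges over a single point, as poles depend on z only. *)
have near_den : \forall r \near (1 : R), forall z a, modulus z = 1 -> [set (0 : 'rV[R]_m)] a ->
    - modulus (horner_complex Q (r%:C * z)) < 0.
  pose h (u : R[i] * 'rV[R]_m) := - modulus (horner_complex Q u.1).
  have ch : continuous h.
    move=> u; apply: (@cvgN R R _ (nbhs u)).
    have c1 : v.1 @[v --> u] --> u.1 by exact: cvg_fst.
    exact: (cvg_comp _ _ (cvg_comp _ _ c1 (@continuous_horner_complex R Q u.1))
      (@continuous_modulus R _)).
  have lt0 z a : modulus z = 1 -> [set (0 : 'rV[R]_m)] a -> h (z, a) < 0.
    move=> z1 _; rewrite /h /= oppr_lt0 -ltcR -normE normr_gt0.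
    by rewrite den0 // z1.
  exact: (near_circle_lt0 (@compact_set1 _ _) ch lt0).
have [e /= e0 ball_e] := filterI near_slope near_den.
pose d : R := Num.max (1 / 2) (1 - e / 2).
have d12 : 1 / 2 <= d by rewrite le_max lexx.
have de : 1 - e / 2 <= d by rewrite le_max lexx orbT.
have d1 : d < 1 by rewrite gt_max; apply/andP; split; lra.
have d0 : 0 < d by lra.
have in_ball r : d <= r -> r <= 1 -> ball (1 : R) e r.
  by move=> dr r1; rewrite /ball /= ger0_norm; lra.
have circle z : 0 < modulus z -> modulus ((modulus z)^-1%:C * z) = 1.
  by move=> z0; rewrite modulusM modulus_real gtr0_norm ?invr_gt0 // mulVf ?gt_eqF.
have scaled z : 0 < modulus z -> (modulus z)%:C * ((modulus z)^-1%:C * z) = z.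
  by move=> z0; rewrite mulrA -rmorphM /= mulfV ?gt_eqF // mul1r.
exists d; split; first by rewrite d0.
  move=> z dz; have [z1|z1] := lerP 1 (modulus z); first exact: den0.
  have z0 : 0 < modulus z by apply: lt_le_trans dz.
  have [_ /(_ _ 0 (circle z z0) erefl)] := ball_e _ (in_ball _ dz (ltW z1)).
  rewrite scaled // oppr_lt0; apply: contraTneq => ->.
  by rewrite modulus_real normr0 ltxx.
move=> z a zd a0; have z0 : 0 < modulus z by rewrite zd.
have [j [aj ja]] := scale_to_face a0.
have [/(_ j _ _ (circle z z0) ja) + _] := ball_e _ (in_ball d (lexx d) (ltW d1)).
rewrite -{1}zd scaled // slope_num_scale pmulr_rlt0 //.
by rewrite exprn_even_gt0 //= invr_eq0.
Qed.

Lemma Im_tf_eval_infty i j :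
  complex.Im (tf_eval G w^-1 i j) @[w --> (0 : R[i])^'] --> (0 : R).
Proof.
have [Ginf Ginf_lim] := G_proper.
have lim : complex.Im (tf_eval G w^-1 i j) @[w --> (0 : R[i])^'] --> complex.Im (Ginf i j).
  apply: cvg_Im; exact: (cvg_comp _ _ Ginf_lim (@coord_continuous _ _ _ i j Ginf)).
(* Approach infinity along the real axis, where G is real. *)
suff <- : complex.Im (Ginf i j) = 0 by [].
have c0 : (t%:C : R[i]) @[t --> (0 : R)^'+] --> (0 : R[i])^'.
  move=> A [e /= e0 eA].
  have [r r0 re] := gt0_complex e0; exists r => //= t t0r t0.
  apply: eA; last by rewrite fmorph_eq0 gt_eqF.
  by move: t0r; rewrite /= re !sub0r !normrN norm_real_complex ltcR.
have limr := cvg_comp _ _ c0 lim.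
have lim0 : (0 : R) @[t --> (0 : R)^'+] --> (0 : R) by exact: cvg_cst.
apply: (cvg_unique (@norm_hausdorff _ R) _ lim0).
apply: cvg_trans limr; apply: near_eq_cvg.
near=> t => /=; rewrite mxE -fmorphV /ratfun_eval !horner_complex_real.
by rewrite -fmorphV -rmorphM.
Unshelve. all: by end_near. Qed.

Lemma Im_form_infty a e : 0 < e -> exists M, forall z, M <= modulus z ->
  complex.Im (f a z) <= e.
Proof.
move=> e0.
have lim : form (ni_real G w^-1) a @[w --> (0 : R[i])^'] --> (0 : R).
  rewrite (_ : 0 = \sum_i \sum_j a 0 i * a 0 j * (- 2 * 0)); last first.
    by rewrite big1 // => i _; rewrite big1 // => j _; rewrite !mulr0.
  under eq_fun do rewrite formE.
  apply: (@cvg_big R _ _ _ _ (@add_continuous R) _ (0 : R[i])^') => i _.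
  apply: (@cvg_big R _ _ _ _ (@add_continuous R) _ (0 : R[i])^') => j _.
  apply: (@cvgM R _ (0 : R[i])^'); first exact: cvg_cst.
  under eq_fun do rewrite mxE.
  apply: (@cvgM R _ (0 : R[i])^'); first exact: cvg_cst.
  exact: Im_tf_eval_infty.
have e2 : - (2 * e) < 0 by lra.
have [r0 /= r00 rlim] := cvgr_gt _ lim _ e2.
have [r rpos rE] := gt0_complex r00.
exists (Num.max 1 (2 / r)) => z; rewrite ge_max => /andP[z1 zr].
have z0 : z != 0.
  by apply: contraTneq z1 => ->; rewrite modulus_real normr0 -ltNge ltr01.
have := rlim z^-1; rewrite /= sub0r normrN rE invrK invr_eq0.
have -> : `|z^-1| < r%:C.
  have zm : 0 < modulus z by lra.
  rewrite normfV normE -fmorphV ltcR -[ltLHS]mul1r ltr_pdivrMr //.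
  have : 2 <= r * modulus z by rewrite mulrC -ler_pdivrMr.
  by lra.
by move=> /(_ isT z0); rewrite form_ni_real ?den0 //; lra.
Qed.

(** With the radius d of a smaller circle, Im (a^T G a) is nonpositive on the
    circle, zero on the real axis and tends to 0 at infinity, so the maximum
    principle gives the sign on the whole region. The point 'i, where
    1/z is the conjugate of z, witnesses the full rank. *)
Lemma circle_DSSNI : DSSNI G.
Proof.
have [d [/andP[d0 d1] dend sloped]] := smaller_circle.
have dne : d != 0 by rewrite gt_eqF.
have le0 a z : d <= modulus z -> 0 <= complex.Im z -> complex.Im (f a z) <= 0.
  apply: (Im_ratio_max d0 dend); last exact: Im_form_infty.
  move=> v vd v0; rewrite Im_ratio mulr_ge0_le0 //.
  rewrite mulr_le0_ge0 //; last by rewrite invr_ge0 addr_ge0 ?sqr_ge0.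
  have [->|a0] := eqVneq a 0; last by apply: ltW; apply: sloped.
  by rewrite -(scale0r (0 : 'rV[R]_m)) slope_num_scale expr0n mul0r.
split.
  exists d; first by rewrite d0.
  have dz z : 1 < `|z| -> d <= modulus (d%:C * z).
    rewrite -[1]/(1%:C) gt_modulus modulusM modulus_real gtr0_norm // => z1.
    by rewrite ler_pMr // ltW.
  split=> [z /dz dz1 i j|z z1].
    rewrite (_ : (fun w => _) = ratfun_eval (ratfun_dilate d (G i j))); last first.
      by apply/funext => x; rewrite !mxE.
    apply: derivable_ratfun_eval => /(pole_dilate _ _ dne) p.
    by have /eqP := dend _ dz1; apply; apply/tf_poleE; exists i, j.
  rewrite tf_eval_dilate // ni_formE //.
  have dw := dz z z1; have Qw := dend _ dw.
  have Imw : complex.Im (d%:C * z) = d * complex.Im z by rewrite Im_realM.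
  split=> z0.
  - apply/possemidef_toC; first exact: ni_real_sym.
    move=> a; rewrite form_ni_real //.
    have := le0 a (d%:C * z) dw; rewrite Imw => /(_ (mulr_ge0 (ltW d0) (ltW z0))).
    by lra.
  - by rewrite ni_real_slope // Imw z0 mulr0 scale0r map_mx0.
  - rewrite /negsemidef -map_mxN; apply/possemidef_toC.
      by rewrite linearN /= ni_real_sym.
    move=> a; rewrite -scaleN1r form_scale form_ni_real //.
    have := le0 a ((d%:C * z)^*); rewrite modulus_conj => /(_ dw).
    rewrite Im_ratio_conj.
    have -> : complex.Im ((d%:C * z)^*) = - (d * complex.Im z).
      by rewrite -Imw; case: (d%:C * z).
    have : 0 <= - (d * complex.Im z) by rewrite -mulrN mulr_ge0 // ?ltW // oppr_gt0.
    by move=> + => -> // => /(_ isT); lra.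
have mi := modulus_i R.
have iV : ('i : R[i])^-1 = ('i)^*.
  apply: (mulfI (x := 'i)); first by rewrite -normr_gt0 normE mi ltcR ltr01.
  rewrite mulfV; first by simpc.
  by rewrite -normr_gt0 normE mi ltcR ltr01.
have Qi : horner_complex Q 'i != 0 by rewrite den0 // mi.
have Qi' : horner_complex Q 'i^-1 != 0 by rewrite iV den0 // modulus_conj mi.
exists 'i.
  split; first by rewrite -normr_gt0 normE mi ltcR ltr01.
    by move=> /tf_poleE; apply/eqP.
  by move=> /tf_poleE; apply/eqP.
have -> : (tf_eval G 'i^-1)^T = (tf_eval G 'i)^t*%sesqui.
  apply/matrixP => i j; rewrite [LHS]mxE [RHS]mxE [X in _ = Num.conj X]mxE.
  rewrite !tf_evalE // iV !horner_complex_conj -[RHS]/((_)^*)%C rmorphM.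
  by rewrite fmorphV.
rewrite -/(ni_form _) ni_formE // det_map_mx fmorph_eq0.
apply/negP => /det0P[a a0 aS].
have := slope_lt0 mi a0; rewrite -form_slope_gt0 //.
have -> : ni_slope G 'i = ni_real G 'i by rewrite ni_real_slope //= scale1r.
by rewrite /form aS mul0mx mxE ltxx.
Qed.

End Backward.

Unset Implicit Arguments.

Theorem theorem6 (R : realType) (m : nat) (G : tf R m)
    (G_sym : symmetric_tf G) (G_proper : proper_tf G) :
  DSSNI G <->
  [/\ forall z : R[i], tf_pole G z -> `|z| < 1,
      forall t : R, 0 < t < pi -> posdef (ni_form (tf_eval G (expi t))),
      exists2 Q0 : 'M[R[i]]_m,
        ((sin t)^-1)%:C *: ni_form (tf_eval G (expi t)) @[t --> 0^'+] --> Q0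
        & posdef Q0
    & exists2 Qpi : 'M[R[i]]_m,
        ((sin t)^-1)%:C *: ni_form (tf_eval G (expi t)) @[t --> pi^'-] --> Qpi
        & posdef Qpi].
Proof.
have polesE : (forall z : R[i], tf_pole G z -> `|z| < 1) <->
    (forall z, 1 <= modulus z -> horner_complex (tf_den G) z != 0).
  split=> [poles z z1|den0 z /tf_poleE Gz].
    by apply/eqP => /tf_poleE/poles; rewrite -[1]/(1%:C) lt_modulus ltNge z1.
  rewrite -[1]/(1%:C) lt_modulus ltNge; apply/negP => /den0.
  by rewrite Gz eqxx.
split=> [/(DSSNI_circle G_sym)[den0 neg]|[/polesE den0 pos pos0 pospi]].
  have [pos pos0 pospi] := (boundary_conditionsP G_sym den0).2 neg.
  by split=> //; apply/polesE.
apply: (circle_DSSNI G_sym G_proper den0).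
exact: (boundary_conditionsP G_sym den0).1.
Qed.
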